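(* For any $-\frac12<d<0$ and $\lambda>0$, let $$\mathcal{A}_2=\Big\{f\in W^{-d,2}(\mathbb{R}):\ \varphi_f=\mathbb{D}^{-d,\lambda}_{-}f\text{ for some }\varphi_f\in L^2(\mathbb{R})\Big\}.$$ Then the class of functions $\mathcal{A}_2$ is a linear space with inner product $$\langle f,g\rangle_{\mathcal{A}_2}:=\langle\varphi_f,\varphi_g\rangle_{L^2(\mathbb{R})}.$$ The set of elementary functions $\mathcal{E}$ is dense in $\mathcal{A}_2$. Moreover, the linear space $\mathcal{A}_2$ (with this inner product) is complete.
   Context: Functions are real-valued and identified when equal a.e. $\widehat f(\omega)$ denotes the $L^2$ Fourier transform with kernel $e^{-i\omega x}$ (up to a fixed normalizing constant). For $\kappa>0$, $\lambda>0$, the fractional Sobolev space is $$W^{\kappa,2}(\mathbb{R})=\Big\{f\in L^2(\mathbb{R}):\int_{\mathbb{R}}(\lambda^2+\omega^2)^{\kappa}|\widehat f(\omega)|^2d\omega<\infty\Big\},$$ which does not depend on $\lambda>0$. For $f\in W^{\kappa,2}(\mathbb{R})$, the negative tempered fractional derivative $\mathbb{D}^{\kappa,\lambda}_{-}f$ is the unique element of $L^2(\mathbb{R})$ with Fourier transform $(\lambda-i\omega)^{\kappa}\widehat f(\omega)$. $\mathcal{E}$ is the space of elementary (step) functions $f=\sum_{i=1}^n a_i\mathbf 1_{[t_i,t_{i+1})}$, with $n\in\mathbb{N}$, $a_i\in\mathbb{R}$ and real numbers $t_1<\cdots<t_{n+1}$. *)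

(* Defs.v *)
From HB Require Import structures.
From mathcomp Require Import all_boot all_order all_algebra.
From mathcomp Require Import complex.
From mathcomp Require Import all_classical all_reals all_analysis.

Set Implicit Arguments.
Unset Strict Implicit.
Unset Printing Implicit Defensive.
Import Order.TTheory GRing.Theory Num.Theory.
Import numFieldNormedType.Exports.
Local Open Scope classical_set_scope.
Local Open Scope complex_scope.
Local Open Scope ring_scope.

Section Fourier.
Context {R : realType}.
Local Notation mu := (@lebesgue_measure R).

Definition L2 : set (R -> R) := [set f | f \in Lfun mu 2%:E].

Definition sqnormc (z : R[i]) : R := complex.Re z ^+ 2 + complex.Im z ^+ 2.

Definition L2C : set (R -> R[i]) :=
  [set g | L2 (fun x => complex.Re (g x)) /\ L2 (fun x => complex.Im (g x))].

Definition cintegral (D : set R) (F : R -> R[i]) : R[i] :=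
  (\int[mu]_(x in D) complex.Re (F x)) +i*
  (\int[mu]_(x in D) complex.Im (F x)).

(* exp (i theta) *)
Definition expi (theta : R) : R[i] := cos theta +i* sin theta.

Definition fourier_trunc (f : R -> R) (n : nat) (w : R) : R[i] :=
  ((Num.sqrt (2 * pi))^-1)%:C *
  cintegral `[- n%:R, n%:R] (fun x => (f x)%:C * expi (- (w * x))).

(* The L^2 Fourier transform is defined only up to a.e. equality, hence a
   relation: g represents the transform of f when the transforms of the
   truncations of f to [-n, n] converge to g in L^2(R; C).  The truncations
   are integrable, so their transforms are ordinary integrals. *)
Definition is_fourier (f : R -> R) (g : R -> R[i]) : Prop :=
  [/\ L2 f, L2C g &
      (fun n : nat => \int[mu]_w (sqnormc (fourier_trunc f n w - g w))%:E)%E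
        @ \oo --> 0%E].

Definition sobolev (kappa lam : R) : set (R -> R) :=
  [set f | L2 f /\ exists2 g, is_fourier f g &
    (\int[mu]_w ((lam ^+ 2 + w ^+ 2) `^ kappa * sqnormc (g w))%:E < +oo)%E].

(* Principal branch of z ^ kappa; the argument of z is the arctangent of
   Im z / Re z only in the half-plane 0 < Re z, where it is used below. *)
Definition cpow (z : R[i]) (kappa : R) : R[i] :=
  (Num.sqrt (sqnormc z) `^ kappa)%:C *
  expi (kappa * atan (complex.Im z / complex.Re z)).

(* phi represents the negative tempered fractional derivative of f. *)
Definition is_tempered_deriv (kappa lam : R) (f phi : R -> R) : Prop :=
  [/\ sobolev kappa lam f, L2 phi &
      exists2 g, is_fourier f g &
        is_fourier phi (fun w => cpow (lam -i* w) kappa * g w)].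

Definition A2 (d lam : R) : set (R -> R) :=
  [set f | sobolev (- d) lam f /\
           exists2 phi, L2 phi & is_tempered_deriv (- d) lam f phi].

Definition A2_phi (d lam : R) (f : R -> R) : R -> R :=
  xget (cst 0) [set phi | is_tempered_deriv (- d) lam f phi].

Definition L2_inner (f g : R -> R) : R := \int[mu]_x (f x * g x).

Definition A2_inner (d lam : R) (f g : R -> R) : R :=
  L2_inner (A2_phi d lam f) (A2_phi d lam g).

Definition elementary : set (R -> R) :=
  [set f | exists (n : nat) (a : 'I_n -> R) (t : nat -> R),
     (forall i : 'I_n, t i < t i.+1) /\
     f = (fun x => \sum_(i < n) a i * \1_(`[t i, t i.+1[%classic) x)].

(* The predicates below speak of spaces of functions modulo a.e. equality:
   V is the set of all measurable representatives. *)
Definition ae_linear_space (V : set (R -> R)) : Prop :=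
  [/\ V (cst 0),
      forall (a : R) f g, V f -> V g -> V (fun x => a * f x + g x) &
      forall f g, V f -> measurable_fun setT g -> f = g %[ae mu] -> V g].

Definition ae_inner_product (V : set (R -> R))
    (ip : (R -> R) -> (R -> R) -> R) : Prop :=
  [/\ forall f g, V f -> V g -> ip f g = ip g f,
      forall (a : R) f g h, V f -> V g -> V h ->
        ip (fun x => a * f x + g x) h = a * ip f h + ip g h,
      forall f, V f -> 0 <= ip f f &
      forall f, V f -> (ip f f = 0 <-> f = cst 0 %[ae mu])].

Definition ip_norm (ip : (R -> R) -> (R -> R) -> R) (f : R -> R) : R :=
  Num.sqrt (ip f f).

Definition ip_dense (V : set (R -> R)) (ip : (R -> R) -> (R -> R) -> R)
    (E : set (R -> R)) : Prop :=
  E `<=` V /\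
  forall f (eps : R), V f -> 0 < eps ->
    exists2 e, E e & ip_norm ip (f \- e) < eps.

Definition ip_complete (V : set (R -> R))
    (ip : (R -> R) -> (R -> R) -> R) : Prop :=
  forall u : nat -> (R -> R),
    (forall n, V (u n)) ->
    (forall eps : R, 0 < eps -> exists N : nat, forall m n : nat,
       (N <= m)%N -> (N <= n)%N -> ip_norm ip (u m \- u n) < eps) ->
    exists2 f, V f & (fun n => ip_norm ip (u n \- f)) @ \oo --> (0 : R).

End Fourier.

(* Main.v *)
Require Import Defs.
From mathcomp Require Import all_boot all_order all_algebra.
From mathcomp Require Import complex ring lra.
From mathcomp Require Import all_classical all_reals all_analysis.
From mathcomp Require Import measurable_realfun.
Import Order.TTheory GRing.Theory Num.Theory.
Import numFieldNormedType.Exports.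
Local Open Scope classical_set_scope.
Local Open Scope ring_scope.

Set Implicit Arguments.
Unset Strict Implicit.
Unset Printing Implicit Defensive.

(* The Fourier transform of a real function [f] is replaced by its Hartley
   transform, with the real symmetric kernel [cas (w x) = cos (w x) + sin (w x)].
   The Fourier transform is Hermitian, and [g |-> Re g - Im g] identifies
   Hermitian functions with real ones, so reality of the functions involved
   never has to be checked separately.

   Plancherel: the transform of the indicator of [a, b) has squared norm
   proportional to [b - a], by scaling of the integral of [(sin w / w)^2]; its
   value is irrelevant.  By additivity in the interval and polarization the
   transform is an isometry, up to a constant, on step functions, hence on L^2.
   It is symmetric by Fubini, so its square is a multiple of the identity and
   it is onto.

   On the Hartley side the multiplier [(lam - i w)^kappa] is multiplication by
   [(lam^2 + w^2)^(kappa/2)] followed by an isometry mixing the values at [w]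
   and [-w].  Completeness of A_2 is therefore completeness of L^2.  Elementary
   functions lie in A_2 because [w^(2 kappa - 2)] is integrable at infinity.  For
   their density, a function orthogonal to every window [a - delta, a + delta)
   yields, after multiplication by the weight and by [sin (delta w) / w], a
   function of L^1 and L^2 whose transform vanishes. *)

(** The obstacle is that [is_fourier] is an L^2 limit of ordinary integrals over [-n, n], whereas
    explicit formulas are available pointwise in w. Fatou's lemma reconciles the two limits whenever
    both occur. The closed formula for an interval fails at w = 0, where division by 0 yields 0, so
    pointwise limits are taken off 0. Completeness passes from L^2 to A_2 because the modulus of the
    multiplier is bounded below by lam^kappa, which is positive: dividing by it keeps L^2, so every
    phi in L^2 is the derivative of some f in L^2. The multiplier has no upper bound, so for step
    functions the decay of their transforms has to compensate; squaring turns the weight into (lam^2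
    + w^2)^kappa, and 2 kappa - 2 < -1 is exactly kappa = -d < 1/2. In the density argument a single
    width delta says nothing at the zeros of sin (delta w). The widths 1/(m+1) leave no w other than
    0 uncovered, and being countably many they keep the union of the exceptional sets null. *)

(* Instance resolution does not see through the semiring-of-sets structure in
   the type of [lebesgue_measure]. *)
#[global] Instance lebesgue_ae_filter (R : realType) :
  Filter (almost_everywhere (@lebesgue_measure R)).
Proof. exact: ae_filter_ringOfSetsType. Qed.

(** * Square-integrable functions *)

Section SquareIntegrable.
Context {R : realType}.
Local Notation mu := (@lebesgue_measure R).
Implicit Types f g h : R -> R.

Lemma L2P f : L2 f <->
  measurable_fun setT f /\ (\int[mu]_x ((f x) ^+ 2)%:E < +oo)%E.
Proof.
split=> [Lf|[mf fy]].
- split; first by move: Lf => /andP[/set_mem].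
  have /integrable_lty := Lfun2_integrable_sqr Lf.
  exact.
- rewrite /L2/=; apply/andP; split; first exact: mem_set.
  rewrite inE /= /finite_norm unlock.
  rewrite poweR_lty//.
  under eq_integral do rewrite /= powR_mulrn// real_normK ?num_real//.
  exact: fy.
Qed.

Lemma L2_measurable f : L2 f -> measurable_fun setT f.
Proof. by move=> /L2P[]. Qed.

Lemma L2_0 : L2 (cst 0 : R -> R).
Proof. by apply/L2P; split=> //; under eq_integral do rewrite expr0n; rewrite integral0. Qed.

Lemma L2_mulr_integrable f g : L2 f -> L2 g ->
  mu.-integrable setT (EFin \o (fun x => f x * g x)).
Proof. by move=> Lf Lg; apply/Lfun1_integrable; exact: Lfun2_mul_Lfun1. Qed.

Lemma L2_lin (a b : R) f g : L2 f -> L2 g -> L2 (fun x => a * f x + b * g x).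
Proof.
move=> Lf Lg; rewrite /L2/=.
have p1 : (1 <= 2%:E :> \bar R)%E by rewrite lee_fin ler1n.
have := @Lfun_submod_closed _ _ _ mu _ p1.
move=> [L0 LZ].
have -> : (fun x => a * f x + b * g x) = a *: f + (b *: g + 0).
  by apply/funext => x; rewrite addr0.
by apply: (LZ a _ _ Lf); apply: (LZ b _ _ Lg).
Qed.

Lemma L2D f g : L2 f -> L2 g -> L2 (fun x => f x + g x).
Proof.
by move=> Lf Lg; have := L2_lin 1 1 Lf Lg; under eq_fun do rewrite !mul1r.
Qed.

Lemma L2B f g : L2 f -> L2 g -> L2 (f \- g).
Proof.
move=> Lf Lg; have := L2_lin 1 (-1) Lf Lg.
by under eq_fun do rewrite mul1r mulN1r.
Qed.

Lemma L2Z (a : R) f : L2 f -> L2 (fun x => a * f x).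
Proof.
by move=> Lf; have := L2_lin a 0 Lf Lf; under eq_fun do rewrite mul0r addr0.
Qed.

Lemma L2_le f g : measurable_fun setT f -> L2 g ->
  (forall x, `|f x| <= `|g x|) -> L2 f.
Proof.
move=> mf /L2P[mg gy] fg; apply/L2P; split=> //.
apply: le_lt_trans gy; apply: ge0_le_integral => //.
- by move=> x _; rewrite lee_fin sqr_ge0.
- by apply/measurable_EFinP; exact: measurable_funX.
- by apply/measurable_EFinP; exact: measurable_funX.
- move=> x _; rewrite lee_fin -(real_normK (num_real (f x))).
  by rewrite -(real_normK (num_real (g x))) lerXn2r ?nnegrE.
Qed.

Lemma L2_inner_EFin f g : L2 f -> L2 g ->
  (L2_inner f g)%:E = (\int[mu]_x (f x * g x)%:E)%E.
Proof.
move=> Lf Lg; rewrite /L2_inner /Rintegral fineK//.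
apply: integrable_fin_num => //; exact: L2_mulr_integrable.
Qed.

Lemma L2_innerC f g : L2_inner f g = L2_inner g f.
Proof. by rewrite /L2_inner; under eq_Rintegral do rewrite mulrC. Qed.

Lemma L2_inner_linl (a b : R) f g h : L2 f -> L2 g -> L2 h ->
  L2_inner (fun x => a * f x + b * g x) h = a * L2_inner f h + b * L2_inner g h.
Proof.
move=> Lf Lg Lh; rewrite /L2_inner.
rewrite -RintegralZl//; last exact: L2_mulr_integrable.
rewrite -RintegralZl//; last exact: L2_mulr_integrable.
rewrite -RintegralD//; last 2 first.
- have := L2_mulr_integrable (L2Z a Lf) Lh.
  by apply: eq_integrable => // x _ /=; rewrite mulrA.
- have := L2_mulr_integrable (L2Z b Lg) Lh.
  by apply: eq_integrable => // x _ /=; rewrite mulrA.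
by apply: eq_Rintegral => x _; rewrite mulrDl !mulrA.
Qed.

Lemma L2_inner_linr (a b : R) f g h : L2 f -> L2 g -> L2 h ->
  L2_inner h (fun x => a * f x + b * g x) = a * L2_inner h f + b * L2_inner h g.
Proof. by move=> *; rewrite L2_innerC L2_inner_linl// ![L2_inner h _]L2_innerC. Qed.

Lemma L2_innerBl f g h : L2 f -> L2 g -> L2 h ->
  L2_inner (f \- g) h = L2_inner f h - L2_inner g h.
Proof.
move=> Lf Lg Lh; have := L2_inner_linl 1 (-1) Lf Lg Lh.
by under eq_fun do rewrite mul1r mulN1r; rewrite mul1r mulN1r.
Qed.

(** Estimates use the squared norm, which avoids square roots until the final statements. A
    divergent integral is sent to 0 by [fine], so a bound on [sqn f] carries information only
    together with [L2 f]. *)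
Definition sqn f : R := L2_inner f f.

Lemma sqn_ge0 f : 0 <= sqn f.
Proof. by apply: Rintegral_ge0 => x _; rewrite -expr2 sqr_ge0. Qed.

Lemma sqn_cst0 : sqn (cst 0) = 0.
Proof.
rewrite /sqn /L2_inner; under eq_Rintegral do rewrite mulr0.
by rewrite Rintegral_cst// mul0r.
Qed.

Lemma sqn_EFin f : L2 f -> (sqn f)%:E = (\int[mu]_x ((f x) ^+ 2)%:E)%E.
Proof.
by move=> Lf; rewrite L2_inner_EFin//; under eq_integral do rewrite -expr2.
Qed.

Lemma sqn_lin (a b : R) f g : L2 f -> L2 g ->
  sqn (fun x => a * f x + b * g x) =
  a ^+ 2 * sqn f + 2 * (a * b) * L2_inner f g + b ^+ 2 * sqn g.
Proof.
move=> Lf Lg; rewrite /sqn L2_inner_linl//; last exact: L2_lin.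
rewrite !L2_inner_linr// (L2_innerC g f); ring.
Qed.

Lemma sqnB f g : L2 f -> L2 g ->
  sqn (f \- g) = sqn f - 2 * L2_inner f g + sqn g.
Proof.
move=> Lf Lg; have := sqn_lin 1 (-1) Lf Lg.
under eq_fun do rewrite mul1r mulN1r; move=> ->; ring.
Qed.

Lemma sqnZ (a : R) f : L2 f -> sqn (fun x => a * f x) = a ^+ 2 * sqn f.
Proof.
move=> Lf; have := sqn_lin a 0 Lf Lf.
under eq_fun do rewrite mul0r addr0; move=> ->; ring.
Qed.

Lemma sqnB_sym f g : sqn (f \- g) = sqn (g \- f).
Proof. by rewrite /sqn /L2_inner; apply: eq_Rintegral => x _ /=; ring. Qed.

(** Parallelogram identity for [f \- g] and [g \- h], with the squared norm of their difference
    dropped. *)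
Lemma sqn_triangle f g h : L2 f -> L2 g -> L2 h ->
  sqn (f \- h) <= 2 * sqn (f \- g) + 2 * sqn (g \- h).
Proof.
move=> Lf Lg Lh.
have Lfg := L2B Lf Lg; have Lgh := L2B Lg Lh.
have := sqn_lin 1 (-1) Lfg Lgh; have := sqn_lin 1 1 Lfg Lgh.
have -> : (fun x => 1 * (f \- g) x + 1 * (g \- h) x) = f \- h.
  by apply/funext => x /=; ring.
have := sqn_ge0 (fun x => 1 * (f \- g) x + (-1) * (g \- h) x).
lra.
Qed.

Lemma cauchy_schwarz f g : L2 f -> L2 g ->
  (L2_inner f g) ^+ 2 <= sqn f * sqn g.
Proof.
move=> Lf Lg; set p := L2_inner f g.
have H (t : R) : 0 <= sqn f + 2 * t * p + t ^+ 2 * sqn g.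
  have := sqn_lin 1 t Lf Lg; rewrite -/p expr1n !mul1r => <-; exact: sqn_ge0.
have [g0|g0] := eqVneq (sqn g) 0.
  rewrite g0 mulr0; have [->|p0] := eqVneq p 0; first by rewrite expr0n.
  (* With [sqn g = 0] the quadratic in t is affine with slope [2 * p]; this t gives it the value
     -1. *)
  have := H (- (sqn f + 1) / (2 * p)); rewrite g0 mulr0 addr0.
  have -> : sqn f + 2 * (- (sqn f + 1) / (2 * p)) * p = -1 by field.
  by rewrite ler0N1.
have gp : 0 < sqn g by rewrite lt_neqAle eq_sym g0 sqn_ge0.
(* The minimizer of the quadratic in t. *)
have := H (- p / sqn g).
have -> : sqn f + 2 * (- p / sqn g) * p + (- p / sqn g) ^+ 2 * sqn g =
  sqn f - p ^+ 2 / sqn g by field.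
by rewrite subr_ge0 ler_pdivrMr.
Qed.

Lemma L2_ae f g : L2 f -> measurable_fun setT g -> f = g %[ae mu] -> L2 g.
Proof.
move=> /L2P[mf fy] mg fg; apply/L2P; split=> //.
suff <- : (\int[mu]_x ((f x) ^+ 2)%:E = \int[mu]_x ((g x) ^+ 2)%:E)%E by [].
apply: ge0_ae_eq_integral => //.
- by apply/measurable_EFinP; exact: measurable_funX.
- by apply/measurable_EFinP; exact: measurable_funX.
- by move=> x _; rewrite lee_fin sqr_ge0.
- by move=> x _; rewrite lee_fin sqr_ge0.
- by apply: filterS fg => x /= H Dx; rewrite H.
Qed.

Lemma L2_inner_ae f f' g g' : L2 f -> L2 g -> L2 f' -> L2 g' ->
  f = f' %[ae mu] -> g = g' %[ae mu] -> L2_inner f g = L2_inner f' g'.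
Proof.
move=> Lf Lg Lf' Lg' ff' gg'; apply: EFin_inj; rewrite !L2_inner_EFin//.
apply: ae_eq_integral => //.
- by apply/measurable_EFinP; apply: measurable_funM; exact: L2_measurable.
- by apply/measurable_EFinP; apply: measurable_funM; exact: L2_measurable.
- apply: filterS2 ff' gg' => x /= H H' Dx; rewrite H ?H'//.
Qed.

Lemma sqn_eq0 f : L2 f -> sqn f = 0 -> f = cst 0 %[ae mu].
Proof.
move=> Lf f0; have := sqn_EFin Lf; rewrite f0 => /esym I0.
have := ae_eq_integral_abs mu measurableT (f := fun x => ((f x) ^+ 2)%:E).
case.
  by apply/measurable_EFinP; apply: measurable_funX; exact: L2_measurable.
move=> + _; under eq_integral do rewrite abse_EFin ger0_norm ?sqr_ge0//.
move=> /(_ I0); apply: filterS => x /= H Dx.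
by have [/eqP] := H Dx; rewrite sqrf_eq0 => /eqP.
Qed.

Lemma sqnB_eq0 f g : L2 f -> L2 g -> sqn (f \- g) = 0 -> f = g %[ae mu].
Proof.
move=> Lf Lg /(sqn_eq0 (L2B Lf Lg)); apply: filterS => x /= H Dx.
by apply/eqP; rewrite -subr_eq0; apply/eqP; exact: H.
Qed.

Lemma sqn_ae f g : L2 f -> L2 g -> f = g %[ae mu] -> sqn f = sqn g.
Proof. by move=> *; apply: L2_inner_ae. Qed.

Lemma sqnB_ae0 f g : L2 f -> L2 g -> f = g %[ae mu] -> sqn (f \- g) = 0.
Proof.
move=> Lf Lg fg; rewrite (sqn_ae (L2B Lf Lg) L2_0); first exact: sqn_cst0.
by apply: filterS fg => x /= H Dx; rewrite H ?subrr.
Qed.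

End SquareIntegrable.

(** * Completeness of L^2 (Riesz-Fischer) *)

Section Completeness.
Context {R : realType}.
Local Notation mu := (@lebesgue_measure R).
Implicit Types f g h : R -> R.

Lemma sqn_fatou (u : nat -> R -> R) f (M : R) : (forall n, L2 (u n)) ->
  (forall x, u n x @[n --> \oo] --> f x) ->
  (\forall n \near \oo, sqn (u n) <= M) -> L2 f /\ sqn f <= M.
Proof.
move=> Lu uf uM.
have mf : measurable_fun setT f.
  by apply: (measurable_fun_cvg (h := u)) => [n|x _]; [exact: L2_measurable|exact: uf].
have eq2 x : limn_einf (fun n => ((u n x) ^+ 2)%:E) = ((f x) ^+ 2)%:E.
  have H : ((u n x) ^+ 2)%:E @[n --> \oo] --> ((f x) ^+ 2)%:E.
    by apply: cvg_EFin; [exact: nearW|rewrite /comp /=; apply: cvgM; exact: uf].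
  exact: (cvg_limn_einf_sup H).1.
have IM : (\int[mu]_x ((f x) ^+ 2)%:E <= M%:E)%E.
  have := @fatou _ _ _ mu setT measurableT (fun n x => ((u n x) ^+ 2)%:E).
  move=> F; apply: le_trans (le_trans (F _ _) _).
  - under [leRHS]eq_integral => x _.
      rewrite (eq2 x); over.
    by [].
  - by move=> n; apply/measurable_EFinP; apply: measurable_funX; exact: L2_measurable.
  - by move=> n x _; rewrite lee_fin sqr_ge0.
  - rewrite limn_einf_lim; apply: lime_le; first exact: is_cvg_einfs.
    apply: filterS uM => n Hn.
    apply: (le_trans _ (y := (sqn (u n))%:E)); last by rewrite lee_fin.
    by rewrite sqn_EFin//; apply: ereal_inf_lbound; exists n => //=.
have Lf : L2 f by apply/L2P; split=> //; apply: le_lt_trans IM _; exact: ltry.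
by split=> //; rewrite -lee_fin sqn_EFin.
Qed.

Definition sqn_cauchy (u : nat -> R -> R) := forall eps : R, 0 < eps ->
  exists N : nat, forall m n : nat,
    (N <= m)%N -> (N <= n)%N -> sqn (u m \- u n) <= eps.

(** Since 8^-k = 4^-k * 2^-k, the series of 4^k * d_k^2 has a finite integral, hence a finite sum on
    a set [A] of full measure. There each term is bounded by the sum, so d_k(x) is O(2^-k) and the
    series of d_k(x) converges absolutely. *)
Lemma ae_cvg_summable (d : nat -> R -> R) : (forall k, L2 (d k)) ->
  (forall k, sqn (d k) <= (8 ^ k)%:R^-1) ->
  exists A : set R, [/\ measurable A, {ae mu, forall x, A x} &
    forall x, A x -> cvgn (series (d ^~ x))].
Proof.
move=> Ld dk.
pose F k x : \bar R := ((4 ^ k)%:R * (d k x) ^+ 2)%:E.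
pose G x : \bar R := (\sum_(0 <= k <oo) F k x)%E.
have F0 k x : (0 <= F k x)%E by rewrite lee_fin mulr_ge0// sqr_ge0.
have mF k : measurable_fun setT (F k).
  apply/measurable_EFinP; apply: measurable_funM => //.
  by apply: measurable_funX; exact: L2_measurable.
have mG : measurable_fun setT G.
  have := @ge0_emeasurable_sum _ _ _ setT F xpredT.
  by apply => // k x _ _; exact: F0.
have G0 x : (0 <= G x)%E by apply: nneseries_ge0 => n _ _; exact: F0.
have IG : (\int[mu]_x G x < +oo)%E.
  rewrite /G integral_nneseries//.
  apply: (@le_lt_trans _ _ (\sum_(0 <= k <oo) (2 / (2 ^ (k + 1))%:R : R)%:E)%E).
    apply: lee_nneseries => [k _ _|k _]; first by apply: integral_ge0 => x _; exact: F0.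
    under eq_integral do rewrite /F EFinM.
    rewrite ge0_integralZl_EFin//; last 2 first.
      by move=> x _; rewrite lee_fin sqr_ge0.
      by apply/measurable_EFinP; apply: measurable_funX; exact: L2_measurable.
    rewrite -(sqn_EFin (Ld k)) -EFinM lee_fin.
    apply: (@le_trans _ _ ((4 ^ k)%:R * (8 ^ k)%:R^-1)); first by rewrite ler_wpM2l.
    rewrite addn1 expnS natrM invfM mulrA divff ?mul1r//.
    rewrite (_ : 8 = 4 * 2)%N// expnMn natrM invfM mulrA divff ?mul1r; first exact: lexx.
    by rewrite pnatr_eq0 -lt0n expn_gt0.
  set S := (X in (X < _)%E).
  suff -> : S = (2 / 2 ^+ 0)%:E by exact: ltry.
  apply/(cvg_lim (@ereal_hausdorff R)).
  exact: (@cvg_geometric_eseries_half R 2 0).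
exists [set x | (G x < +oo)%E]; split.
- have := @measurable_lte _ _ R setT measurableT G (cst +oo%E) mG.
  by rewrite setTI; apply.
- have /(integrable_ae measurableT) : mu.-integrable setT G.
    apply/integrableP; split=> //.
    by under eq_integral do rewrite gee0_abs//.
  apply: filterS => x /= /(_ I); rewrite ge0_fin_numE//.
- move=> x /= Gx.
  have Gfin : G x \is a fin_num by rewrite ge0_fin_numE.
  pose B := fine (G x).
  have GB : G x = B%:E by rewrite fineK.
  have FB k : (4 ^ k)%:R * (d k x) ^+ 2 <= B.
    rewrite -lee_fin -GB; have := @nneseries_lim_ge R (F ^~ x) xpredT 0%N k.+1.
    move=> /(_ (fun n _ _ => F0 n x)); apply: le_trans.
    rewrite big_nat_recr//= leeDr//.
    by apply: sume_ge0 => i _; exact: F0.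
  have B0 : 0 <= B by rewrite -lee_fin -GB.
  apply: normed_cvg.
  apply: (@series_le_cvg R _ (geometric (1 + B) 2^-1)) => [n|n|n|]/=.
  + exact: normr_ge0.
  + by rewrite mulr_ge0 ?exprn_ge0// addr_ge0.
  + have := FB n.
    rewrite exprVn ler_pdivlMr; last by rewrite exprn_gt0.
    rewrite (_ : 4 = 2 * 2)%N// expnMn natrM natrX.
    have -> : 2 ^+ n * 2 ^+ n * d n x ^+ 2 = (`|d n x| * 2 ^+ n) ^+ 2.
      by rewrite exprMn real_normK ?num_real//; ring.
    (* From z^2 <= B follows z <= 1 + B, which spares a square root of B. *)
    set z := `|d n x| * 2 ^+ n => zB.
    have : 0 <= z by rewrite mulr_ge0// exprn_ge0.
    nra.
  + apply: is_cvg_geometric_series.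
    by rewrite ger0_norm; lra.
Qed.

Lemma L2_complete (u : nat -> R -> R) : (forall n, L2 (u n)) -> sqn_cauchy u ->
  exists2 f, L2 f & sqn (u n \- f) @[n --> \oo] --> (0 : R).
Proof.
move=> Lu Cu.
have e8 (k : nat) : 0 < (8 ^ k)%:R^-1 :> R by rewrite invr_gt0 ltr0n expn_gt0.
have /choice[N HN] : forall k : nat, exists N : nat, forall m n : nat,
    (N <= m)%N -> (N <= n)%N -> sqn (u m \- u n) <= (8 ^ k)%:R^-1.
  by move=> k; exact: Cu.
(* The maximum puts [phi k] beyond every [N i] with i <= k; the summand k makes the subsequence
   cofinal. *)
pose phi k := (k + \max_(i < k.+1) N i)%N.
have Nphi k j : (k <= j)%N -> (N k <= phi j)%N.
  move=> kj; rewrite /phi (leq_trans _ (leq_addl _ _))//.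
  exact: (leq_bigmax (F := fun i : 'I_j.+1 => N i) (Ordinal (kj : (k < j.+1)%N))).
pose w k := u (phi k).
have Lw k : L2 (w k) by exact: Lu.
pose d k := w k.+1 \- w k.
have Ld k : L2 (d k) by exact: L2B.
have [|A [mA aeA cA]] := ae_cvg_summable Ld.
  by move=> k; apply: HN; exact: Nphi.
(* Zeroing off [A] makes the subsequence converge at every x, so its limit is a genuine function,
   and Fatou applies to [u n \- w' k] as k grows. *)
pose w' k := (fun x => \1_A x * w k x).
have w'w k : w' k = w k %[ae mu].
  by apply: filterS aeA => x Ax _; rewrite /w' indicE mem_set// mul1r.
have Lw' k : L2 (w' k).
  apply: (L2_ae (Lw k)).
    by apply: measurable_funM => //; exact: L2_measurable.
  by apply: filterS (w'w k) => x H Dx; rewrite H.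
have cw' x : cvgn (w' ^~ x).
  rewrite /w' indicE; have [/set_mem Ax|nAx] := boolP (x \in A); last first.
    by under eq_fun do rewrite mul0r; exact: is_cvg_cst.
  under eq_fun do rewrite mul1r.
  have := cA x Ax => /cvg_ex[l Hl]; apply/cvg_ex; exists (l + w 0%N x).
  have E : w ^~ x = fun n => series (d ^~ x) n + w 0%N x.
    by apply/funext => n; rewrite addrC; exact: (eq_sum_telescope (w ^~ x) n).
  by rewrite E; apply: cvgD => //; exact: cvg_cst.
pose f x := limn (w' ^~ x).
have fatou_w n eps : (\forall k \near \oo, sqn (u n \- w k) <= eps) ->
    L2 (u n \- f) /\ sqn (u n \- f) <= eps.
  move=> H; apply: (@sqn_fatou (fun k => u n \- w' k)).
  - by move=> k; exact: L2B.
  - by move=> x; apply: cvgB; [exact: cvg_cst|exact: cw'].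
  - apply: filterS H => k Hk; rewrite (sqn_ae _ _ (g := u n \- w k))//.
    + exact: L2B.
    + exact: L2B.
    + by apply: filterS (w'w k) => x Hx Dx /=; rewrite Hx.
have bound eps : 0 < eps -> exists M, forall n, (M <= n)%N ->
    L2 (u n \- f) /\ sqn (u n \- f) <= eps.
  move=> e0; have [M HM] := Cu eps e0; exists M => n Mn.
  apply: fatou_w; exists M => // k /= Mk; apply: HM => //.
  by rewrite (leq_trans Mk)// /phi leq_addr.
have Lf : L2 f.
  have [M /(_ M (leqnn _))[LMf _]] := bound 1 ltr01.
  have := L2B (Lu M) LMf; congr L2; apply/funext => x /=; ring.
exists f => //; apply/cvgrPdist_le => eps e0.
have [M HM] := bound eps e0.
exists M => // n /= Mn; rewrite sub0r normrN ger0_norm ?sqn_ge0//.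
by have [] := HM n Mn.
Qed.

End Completeness.

(** * Convergence, projection and density in L^2 *)

Section L2Convergence.
Context {R : realType}.
Local Notation mu := (@lebesgue_measure R).
Implicit Types f g h q : R -> R.

Definition L2cvg (u : nat -> R -> R) f := sqn (u n \- f) @[n --> \oo] --> (0 : R).

Lemma cvg_cstM (a l : R) (x : nat -> R) : x n @[n --> \oo] --> l ->
  a * x n @[n --> \oo] --> a * l.
Proof. by move=> xl; apply: (@cvgM _ _ _ _ (cst a) x) => //; exact: cvg_cst. Qed.

Lemma cvg_Mcst (a l : R) (x : nat -> R) : x n @[n --> \oo] --> l ->
  x n * a @[n --> \oo] --> l * a.
Proof. by move=> xl; rewrite mulrC; under eq_fun do rewrite mulrC; exact: cvg_cstM. Qed.

Lemma sqr_cvg0 (x : nat -> R) (y : nat -> R) :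
  (forall n, (x n) ^+ 2 <= y n) -> y n @[n --> \oo] --> (0 : R) ->
  x n @[n --> \oo] --> (0 : R).
Proof.
move=> xy /cvgrPdist_le y0; apply/cvgrPdist_le => e e0.
have := y0 (e ^+ 2) (exprn_gt0 _ e0); apply: filterS => n.
rewrite !sub0r !normrN => yn.
rewrite -(@ler_pXn2r _ 2)// ?nnegrE ?normr_ge0 ?(ltW e0)// real_normK ?num_real//.
by apply: (le_trans (xy n)); apply: (le_trans _ yn); exact: ler_norm.
Qed.

Lemma L2cvg_inner (u : nat -> R -> R) f g : (forall n, L2 (u n)) -> L2 f -> L2 g ->
  L2cvg u f -> L2_inner (u n) g @[n --> \oo] --> L2_inner f g.
Proof.
move=> Lu Lf Lg uf; apply/subr_cvg0.
apply: (sqr_cvg0 (y := fun n => sqn (u n \- f) * sqn g)) => [n|].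
  rewrite -L2_innerBl//; apply: cauchy_schwarz => //; exact: L2B.
by rewrite -(mul0r (sqn g)); exact: cvg_Mcst.
Qed.

Lemma L2cvg_sqn (u : nat -> R -> R) f : (forall n, L2 (u n)) -> L2 f ->
  L2cvg u f -> sqn (u n) @[n --> \oo] --> sqn f.
Proof.
move=> Lu Lf uf.
have -> : (fun n => sqn (u n)) =
    (fun n => sqn (u n \- f) + 2 * L2_inner (u n) f - sqn f).
  by apply/funext => n; rewrite sqnB//; ring.
rewrite [X in _ --> X](_ : _ = 0 + 2 * L2_inner f f - sqn f); last first.
  by rewrite /sqn; ring.
apply: cvgB; last exact: cvg_cst.
by apply: cvgD => //; apply: cvg_cstM; exact: L2cvg_inner.
Qed.

Lemma le_cvg0 (x y : nat -> R) : (forall n, 0 <= x n <= y n) ->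
  y n @[n --> \oo] --> (0 : R) -> x n @[n --> \oo] --> (0 : R).
Proof.
move=> xy y0; apply: (@squeeze_cvgr _ _ _ _ (cst 0) y) => //.
- exact: nearW.
- exact: cvg_cst.
Qed.

Lemma sqn_lin_le (a b : R) f g : L2 f -> L2 g ->
  sqn (fun x => a * f x + b * g x) <= 2 * a ^+ 2 * sqn f + 2 * b ^+ 2 * sqn g.
Proof.
move=> Lf Lg; have := sqn_ge0 (fun x => a * f x + (- b) * g x).
rewrite !sqn_lin//; lra.
Qed.

Lemma L2cvg_lin (a b : R) (u v : nat -> R -> R) f g :
  (forall n, L2 (u n)) -> (forall n, L2 (v n)) -> L2 f -> L2 g ->
  L2cvg u f -> L2cvg v g ->
  L2cvg (fun n x => a * u n x + b * v n x) (fun x => a * f x + b * g x).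
Proof.
move=> Lu Lv Lf Lg uf vg.
apply: (le_cvg0 (y := fun n => 2 * a ^+ 2 * sqn (u n \- f) +
    2 * b ^+ 2 * sqn (v n \- g))) => [n|].
  rewrite sqn_ge0 /=.
  have Luf := L2B (Lu n) Lf; have Lvg := L2B (Lv n) Lg.
  have -> : (fun x => a * u n x + b * v n x) \- (fun x => a * f x + b * g x) =
      (fun x => a * (u n \- f) x + b * (v n \- g) x).
    by apply/funext => x /=; ring.
  exact: sqn_lin_le.
have -> : 0 = 2 * a ^+ 2 * 0 + 2 * b ^+ 2 * 0 :> R by ring.
by apply: cvgD; exact: cvg_cstM.
Qed.

Lemma L2cvg_unique (u : nat -> R -> R) f g : (forall n, L2 (u n)) ->
  L2 f -> L2 g -> L2cvg u f -> L2cvg u g -> f = g %[ae mu].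
Proof.
move=> Lu Lf Lg uf ug; apply: sqnB_eq0 => //.
suff : (fun=> sqn (f \- g)) n @[n --> \oo] --> (0 : R).
  by move=> /(cvg_lim (@Rhausdorff R)); rewrite lim_cst.
apply: (le_cvg0 (y := fun n => 2 * sqn (u n \- f) + 2 * sqn (u n \- g))) => [n|].
  by rewrite sqn_ge0/= [sqn (u n \- f)]sqnB_sym sqn_triangle.
have -> : 0 = 2 * 0 + 2 * 0 :> R by ring.
by apply: cvgD; exact: cvg_cstM.
Qed.

(** Fatou on [u n \- f], whose squared norms eventually lie below any e, bounds [sqn (g \- f)] by e;
    that g is in L^2 comes out of the same bound. *)
Lemma L2cvg_pointwise (u : nat -> R -> R) f g : (forall n, L2 (u n)) -> L2 f ->
  L2cvg u f -> (forall x, u n x @[n --> \oo] --> g x) ->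
  L2 g /\ f = g %[ae mu].
Proof.
move=> Lu Lf uf ug.
have H e : 0 < e -> L2 (g \- f) /\ sqn (g \- f) <= e.
  move=> e0; apply: (@sqn_fatou _ (fun n => u n \- f)).
  - by move=> n; exact: L2B.
  - by move=> x; apply: cvgB => //; exact: cvg_cst.
  - move/cvgrPdist_le: uf => /(_ e e0); apply: filterS => n.
    by rewrite sub0r normrN ger0_norm ?sqn_ge0.
have Lgf := (H 1 ltr01).1.
have Lg : L2 g.
  by have := L2D Lgf Lf; congr L2; apply/funext => x /=; ring.
split=> //; apply: sqnB_eq0 => //; rewrite sqnB_sym.
apply/eqP; rewrite eq_le sqn_ge0 andbT; apply/ler_addgt0Pl => e e0.
by rewrite addr0; exact: (H e e0).2.
Qed.

Lemma L2cvg_ae_r (u : nat -> R -> R) f g : (forall n, L2 (u n)) ->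
  L2 f -> L2 g -> f = g %[ae mu] -> L2cvg u f -> L2cvg u g.
Proof.
move=> Lu Lf Lg fg; rewrite /L2cvg.
suff -> : (fun n => sqn (u n \- g)) = (fun n => sqn (u n \- f)) by [].
apply/funext => n; apply: sqn_ae; [exact: L2B|exact: L2B|].
by apply: filterS fg => x /= H Dx; rewrite H.
Qed.

Lemma L2cvg_cauchy (u : nat -> R -> R) f : (forall n, L2 (u n)) -> L2 f ->
  L2cvg u f -> sqn_cauchy u.
Proof.
move=> Lu Lf /cvgrPdist_le uf e e0.
have e4 : 0 < e / 4 by rewrite divr_gt0.
have [N _ HN] := uf _ e4; exists N => m n Nm Nn.
have := sqn_triangle (Lu m) Lf (Lu n).
have := HN m Nm; have := HN n Nn.
rewrite /= !sub0r !normrN !ger0_norm ?sqn_ge0// [sqn (f \- _)]sqnB_sym; lra.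
Qed.

(* The residuals of a minimizing sequence are Cauchy by the parallelogram
   identity; their limit is orthogonal to [M], hence null. *)
Lemma L2_dense_of_orthogonal (M : set (R -> R)) :
  M (cst 0) -> (forall f, M f -> L2 f) ->
  (forall a f g, M f -> M g -> M (fun x => a * f x + g x)) ->
  (forall q, L2 q -> (forall m, M m -> L2_inner q m = 0) -> q = cst 0 %[ae mu]) ->
  forall f, L2 f -> forall eps : R, 0 < eps -> exists2 m, M m & sqn (f \- m) < eps.
Proof.
move=> M0 ML Mlin Morth f Lf eps eps0.
pose S := [set sqn (f \- m) | m in M].
have S0 : has_inf S.
  split; first by exists (sqn (f \- cst 0)); exists (cst 0).
  by exists 0 => _ [m _ <-]; exact: sqn_ge0.
pose D := inf S.
have DM m : M m -> D <= sqn (f \- m) by move=> Mm; apply: ge_inf; [exact: S0.2|exists m].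
have e0 (k : nat) : 0 < k.+1%:R^-1 :> R by rewrite invr_gt0.
have /choice[m Hm] : forall k : nat, exists m, M m /\ sqn (f \- m) < D + k.+1%:R^-1.
  by move=> k; have [_ [m Mm <-] ?] := inf_adherent (e0 k) S0; exists m.
have Lm k : L2 (m k) by apply: ML; exact: (Hm k).1.
pose q k := f \- m k.
have Lq k : L2 (q k) by exact: L2B.
have qD k : sqn (q k) < D + k.+1%:R^-1 by exact: (Hm k).2.
have Cq : sqn_cauchy q.
  (* The midpoint of [m i] and [m j] is in [M], so the parallelogram identity bounds
     [sqn (q i \- q j)] by 2/(i+1) + 2/(j+1), which is below e once both reciprocals are below
     e/4. *)
  move=> e ep; have [N _ HN] := near_infty_natSinv_lt (PosNum (divr_gt0 ep (ltr0n R 4))).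
  exists N => i j Ni Nj; have /= Hi := HN i Ni; have /= Hj := HN j Nj.
  have Mij : M (fun x => 2^-1 * m i x + (2^-1 * m j x + cst 0 x)).
    by apply: (Mlin); [exact: (Hm i).1|apply: Mlin => //; exact: (Hm j).1].
  have := DM _ Mij.
  have -> : f \- (fun x => 2^-1 * m i x + (2^-1 * m j x + cst 0 x)) =
      (fun x => 2^-1 * q i x + 2^-1 * q j x).
    by apply/funext => x; rewrite /q /=; lra.
  rewrite sqn_lin// sqnB//.
  have := qD i; have := qD j; move: Hi Hj.
  move: (L2_inner _ _) (sqn (q i)) (sqn (q j)) (i.+1%:R^-1) (j.+1%:R^-1) => x y z s t.
  rewrite exprVn; lra.
have [g Lg qg] := L2_complete Lq Cq.
(* Moving [m k] by [t * h] inside [M] cannot bring the squared distance below [D]. *)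
have orth k t h : M h -> 2 * t * L2_inner (q k) h - t ^+ 2 * sqn h <= k.+1%:R^-1.
  move=> Mh; have Mk : M (fun x => t * h x + m k x) by apply: Mlin => //; exact: (Hm k).1.
  have := DM _ Mk.
  have -> : f \- (fun x => t * h x + m k x) = (fun x => 1 * q k x + (- t) * h x).
    by apply/funext => x; rewrite /q /=; ring.
  rewrite sqn_lin//; last exact: ML.
  have := qD k; move: (L2_inner _ _) (sqn (q k)) (k.+1%:R^-1) => x y z.
  rewrite expr1n sqrrN; lra.
have gorth h : M h -> L2_inner g h = 0.
  move=> Mh; have Lh := ML _ Mh.
  have C1 := L2cvg_inner Lq Lg Lh qg.
  suff C2 : L2_inner (q n) h @[n --> \oo] --> (0 : R).
    exact: (cvg_unique (@Rhausdorff R) C1 C2).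
  apply: (sqr_cvg0 (y := fun k => k.+1%:R^-1 * (sqn h + 1))) => [k|].
    set p := L2_inner (q k) h; have sh := sqn_ge0 h.
    have s1 : 0 < sqn h + 1 by lra.
    (* A near-optimal t; the added 1 keeps the denominator positive when [sqn h = 0]. *)
    have := orth k (p / (sqn h + 1)) h Mh; rewrite -/p => H.
    rewrite -ler_pdivrMr//; apply: le_trans H.
    have -> : 2 * (p / (sqn h + 1)) * p - (p / (sqn h + 1)) ^+ 2 * sqn h =
        p ^+ 2 / (sqn h + 1) + (p / (sqn h + 1)) ^+ 2 by field; lra.
    by rewrite lerDl sqr_ge0.
  rewrite -(mul0r (sqn h + 1)); apply: cvg_Mcst.
  exact: cvg_harmonic.
have g0 := Morth g Lg gorth.
have := L2cvg_sqn Lq Lg qg.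
have -> : sqn g = 0 by rewrite (sqn_ae Lg L2_0 g0) sqn_cst0.
move=> /cvgrPdist_lt /(_ eps eps0)[N _ HN].
exists (m N); first exact: (Hm N).1.
by have := HN N (leqnn N); rewrite /= sub0r normrN ger0_norm ?sqn_ge0.
Qed.

Lemma L2_indic (A : set R) : measurable A -> (mu A < +oo)%E -> L2 (\1_A : R -> R).
Proof.
move=> mA A_fin; apply/L2P; split; first exact: measurable_indic.
under eq_integral do rewrite indicE -natrX expnE; rewrite /=.
under eq_integral do rewrite mulnb andbb.
by have := integral_indic mu measurableT mA; rewrite setIT => ->.
Qed.

Lemma L2_integrable_on (A : set R) f : measurable A -> (mu A < +oo)%E -> L2 f ->
  mu.-integrable A (EFin \o f).
Proof.
move=> mA A_fin Lf; apply/integrable_mkcond => //.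
have := L2_mulr_integrable Lf (L2_indic mA A_fin).
apply: eq_integrable => // x _; rewrite /= patchE indicE.
by case: ifPn => _; rewrite ?mulr1 ?mulr0.
Qed.

Lemma L2_inner_indic (A : set R) f : L2_inner f (\1_A) = \int[mu]_(x in A) f x.
Proof.
rewrite /L2_inner [RHS]Rintegral_mkcond; apply: eq_Rintegral => x _.
by rewrite patchE indicE; case: ifPn => _; rewrite ?mulr1 ?mulr0.
Qed.

(** At a Lebesgue point x the primitive of q has derivative q x, and the primitive is identically 0.
    Its base point is x - 1 because q is integrable only on bounded sets. *)
Lemma L2_orthogonal_itv_eq0 q : L2 q ->
  (forall a b, a < b -> \int[mu]_(x in `[a, b[) q x = 0) -> q = cst 0 %[ae mu].
Proof.
move=> Lq q0.
have itvfin (a b : R) : (mu `[a, b]%classic < +oo)%E.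
  by rewrite lebesgue_measure_itv; case: ifPn => _; rewrite -?EFinB ltry.
have lq : locally_integrable setT q.
  split; [exact: L2_measurable|exact: openT|move=> K _ cK].
  have mK := compact_measurable cK.
  have K_fin : (mu K < +oo)%E by exact: compact_finite_measure.
  by have /integrableP[] := L2_integrable_on mK K_fin Lq.
apply: filterS (lebesgue_differentiation lq) => x Lx _.
have xx1 : x < x + 1 by rewrite ltrDl.
have x1 : (BLeft (x - 1)%R < BRight x)%E by rewrite lte_fin ltrBlDr ltrDl.
have iq := L2_integrable_on (measurable_itv `[x - 1, x + 1]) (itvfin _ _) Lq.
have [_ <-] := FTC1_lebesgue_pt xx1 iq x1 Lx.
rewrite (_ : (fun y => _) = cst 0) ?derive1_cst//.
apply/funext => y; rewrite /= -Rintegral_itv_bndo_bndc.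
  have [xy|yx] := ltP (x - 1) y; first exact: q0.
  by rewrite set_itv_ge ?Rintegral_set0// -leNgt.
apply: L2_integrable_on => //.
have := itvfin (x - 1) y; apply: le_lt_trans; apply: le_measure; rewrite ?inE//.
by move=> z /=; rewrite !in_itv/= => /andP[-> /ltW].
Qed.

End L2Convergence.

(** * Integral estimates for the cardinal sine *)

Section IntegralEstimates.
Context {R : realType}.
Local Notation mu := (@lebesgue_measure R).
Implicit Types (f g : R -> R) (a b w x : R).

Lemma lebesgue_itv_lty (b0 b1 : bool) a b :
  (mu [set` Interval (BSide b0 a) (BSide b1 b)] < +oo)%E.
Proof.
by rewrite lebesgue_measure_itv; case: ifPn => _; rewrite -?EFinB ltry.
Qed.

(** The pushforward of [mu] under multiplication by a, multiplied by a, gives ]c, e] its length, so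
    it is Lebesgue measure by uniqueness. *)
Lemma ge0_integral_scale a (F : R -> \bar R) : 0 < a ->
  measurable_fun setT F -> (forall x, 0 <= F x)%E ->
  (\int[mu]_x F x = a%:E * \int[mu]_x F (a * x)%R)%E.
Proof.
move=> a0 mF F0.
have mphi : measurable_fun setT ( *%R a : R -> measurableTypeR R).
  exact: measurable_funM.
pose P := measure_function_pushforward__canonical__measure_function_Measure mu mphi.
pose nu := mscale (NngNum (ltW a0)) P.
transitivity (\int[nu]_x F x)%E.
  apply: eq_measure_integral => A mA _.
  apply: lebesgue_measure_unique => // _ [[c e]] _ <-.
  change (mu `]c, e] = a%:E * mu ( *%R a @^-1` `]c, e]%classic))%E.
  rewrite [X in (_ * mu X)%E](_ : _ = `]c / a, e / a]%classic); last first.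
    apply/seteqP; split => x /=; rewrite !in_itv/= => /andP[];
    by rewrite ltr_pdivrMr// ler_pdivlMr// mulrC => -> ->.
  rewrite !lebesgue_measure_itv/= !lte_fin ltr_pM2r ?invr_gt0//.
  case: ifPn => _; last by rewrite mule0.
  by rewrite -!EFinB -EFinM -mulrBl mulrCA divff ?gt_eqF ?mulr1.
rewrite ge0_integral_mscale//=; congr (_ * _)%E.
by rewrite ge0_integral_pushforward.
Qed.

Lemma ge0_integral_reflect (F : R -> \bar R) :
  measurable_fun setT F -> (forall x, 0 <= F x)%E ->
  (\int[mu]_x F (- x)%R = \int[mu]_x F x)%E.
Proof.
move=> mF F0.
transitivity (\int[pushforward mu (-%R : _ -> measurableTypeR R)]_x F x)%E.
  by rewrite ge0_integral_pushforward.
by apply: eq_measure_integral => A mA _; exact: lebesgue_measureN.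
Qed.

(** Inversion is discontinuous at 0, so measurability is borrowed from the real power; at 0 both
    sides are 0. *)
Lemma measurable_inv : measurable_fun setT (@GRing.inv R).
Proof.
have -> : @GRing.inv R = (fun x => x * (x ^+ 2) `^ (-1)).
  apply/funext => x; rewrite powR_inv1 ?sqr_ge0//.
  have [->|x0] := eqVneq x 0; first by rewrite invr0 mul0r.
  by field.
apply: measurable_funM => //; apply: (measurableT_comp (measurable_powR _)).
exact: measurable_funX.
Qed.

Lemma norm_sin_le x : `|sin x| <= `|x|.
Proof.
have H (y : R) : 0 <= y -> `|sin y| <= y.
  move=> y0; have cs : {within `[0, y], continuous (@sin R)}.
    by apply: continuous_subspaceT => z; exact: continuous_sin.
  have [c _] := MVT_segment y0 (fun z _ => is_derive_sin z) cs.
  rewrite sin0 !subr0 => ->; rewrite normrM (ger0_norm y0).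
  by rewrite ler_piMl// cos_max.
have [x0|x0] := leP 0 x; first by rewrite (ger0_norm x0) H.
by rewrite -normrN -sinN (ltr0_norm x0) H// oppr_ge0 ltW.
Qed.

(** Half the integral of cos (w x) over [-a, a], for w other than 0. At w = 0 the value is 0 instead
    of the limit a; the bounds below hold there too. *)
Definition sinc (a w : R) : R := sin (a * w) / w.

Lemma measurable_sinc a : measurable_fun setT (sinc a).
Proof.
apply: measurable_funM; last exact: measurable_inv.
apply: measurableT_comp; last exact: measurable_funM.
by apply: continuous_measurable_fun; exact: continuous_sin.
Qed.

Lemma norm_sinc_le a w : `|sinc a w| <= `|a|.
Proof.
have [->|w0] := eqVneq w 0; first by rewrite /sinc invr0 mulr0 normr0.
rewrite normrM normfV ler_pdivrMr ?normr_gt0// -normrM.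
exact: norm_sin_le.
Qed.

Lemma norm_sinc_le_inv a w : `|sinc a w| <= `|w|^-1.
Proof. by rewrite normrM normfV ler_piMl ?invr_ge0// sin_max. Qed.

Lemma sincN a w : sinc a (- w) = sinc a w.
Proof. by rewrite /sinc mulrN sinN invrN mulrNN. Qed.

Lemma powR_cvg_pinfty0 (s : R) : 0 < s -> x `^ (- s) @[x --> +oo%R] --> (0 : R).
Proof.
move=> s0; apply/cvgrPdist_le => e e0; near=> x.
have x0 : 0 < x by near: x; exact: nbhs_pinfty_gt.
rewrite sub0r normrN ger0_norm ?powR_ge0// powRN.
have xA : e `^ (- s^-1) <= x by near: x; apply: nbhs_pinfty_ge; exact: num_real.
rewrite invf_ple ?posrE ?powR_gt0//.
have <- : (e `^ (- s^-1)) `^ s = e^-1.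
  by rewrite -powRrM mulNr mulVf ?gt_eqF// powR_inv1 ?ltW.
by apply: ge0_ler_powR => //; rewrite ?nnegrE ?powR_ge0// ltW.
Unshelve. all: end_near. Qed.

Lemma integral_powR_tail (s : R) : 1 < s ->
  (\int[mu]_(x in `[1%R, +oo[) (x `^ (- s))%:E < +oo)%E.
Proof.
move=> s1.
have cp (r x : R) : 0 < x -> {for x, continuous (fun x => x `^ r)}.
  move=> x0; apply: differentiable_continuous; apply/derivable1_diffP.
  by apply: derivable_powR; rewrite in_itv/= x0.
rewrite (@ge0_continuous_FTC2y R (fun x => x `^ (- s))
  (fun x => (1 - s)^-1 * x `^ (- (s - 1))) 1 0).
- by rewrite -EFinB ltry.
- by move=> x _; exact: powR_ge0.
- apply: continuous_in_subspaceT => x; rewrite inE/= in_itv/= andbT => x1.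
  by apply: cp; exact: lt_le_trans x1.
- rewrite -(mulr0 ((1 - s)^-1)); apply: cvgM; first exact: cvg_cst.
  by apply: powR_cvg_pinfty0; rewrite subr_gt0.
- move=> x x1; apply: derivableM => //.
  by apply: derivable_powR; rewrite in_itv/= (lt_trans ltr01).
- apply: cvg_at_right_filter; apply: cvgM; first exact: cvg_cst.
  exact: cp.
- move=> x; rewrite in_itv/= andbT => x1.
  have x0 : 0 < x by exact: lt_trans x1.
  rewrite derive1Ml; last by apply: derivable_powR; rewrite in_itv/= x0.
  rewrite powR_derive1; last by rewrite in_itv/= x0.
  rewrite mulrA opprB mulVf ?mul1r; first by congr (_ `^ _); ring.
  by rewrite subr_eq0 lt_eqF.
Qed.

(** Near 0 the bound |sinc| <= |a| makes the integrand bounded; for |w| >= 1 the bound 1/|w| makes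
    it O(|w|^(2 kappa - 2)), and 2 - 2 kappa > 1. The constant (lam^2 + 1)^kappa serves both ranges,
    as lam^2 + w^2 is at most lam^2 + 1 in the first and (lam^2 + 1) w^2 in the second. *)
Lemma integral_weight_sinc (lam kappa a : R) : 0 <= kappa < 2^-1 ->
  (\int[mu]_w ((lam ^+ 2 + w ^+ 2) `^ kappa * (sinc a w) ^+ 2)%:E < +oo)%E.
Proof.
move=> /andP[k0 k1].
pose G w := (lam ^+ 2 + w ^+ 2) `^ kappa * (sinc a w) ^+ 2.
have G0 w : (0 <= (G w)%:E)%E by rewrite lee_fin mulr_ge0 ?powR_ge0 ?sqr_ge0.
have mG : measurable_fun setT G.
  apply: measurable_funM; last by apply: measurable_funX; exact: measurable_sinc.
  apply: (measurableT_comp (measurable_powR _)).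
  by apply: measurable_funD => //; exact: measurable_funX.
pose C := (lam ^+ 2 + 1) `^ kappa.
have C0 : 0 <= C by exact: powR_ge0.
pose T w := w `^ (- (2 - 2 * kappa)) * \1_(`[1, +oo[%classic : set R) w.
have K0 : 0 <= C * a ^+ 2 by rewrite mulr_ge0 ?sqr_ge0.
pose F w := C * a ^+ 2 * \1_(`[-1, 1]%classic : set R) w.
have T0 w : 0 <= T w by rewrite mulr_ge0 ?powR_ge0 ?indicE.
have F0 w : 0 <= F w by rewrite mulr_ge0 ?indicE.
have mT : measurable_fun setT T.
  by apply: measurable_funM => //; exact: measurable_powR.
have mF : measurable_fun setT F by exact: measurable_funM.
have IT : (\int[mu]_w (T w)%:E < +oo)%E.
  have -> : (\int[mu]_w (T w)%:E = \int[mu]_(w in `[1%R, +oo[) (w `^ (- (2 - 2 * kappa)))%:E)%E.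
    rewrite [RHS]integral_mkcond; apply: eq_integral => w _.
    by rewrite patchE /T indicE; case: ifPn => _; rewrite ?mulr1 ?mulr0.
  by apply: integral_powR_tail; lra.
have IF : (\int[mu]_w (F w)%:E < +oo)%E.
  rewrite /F; under eq_integral do rewrite EFinM.
  rewrite ge0_integralZl_EFin//; last by exact/measurable_EFinP.
  rewrite integral_indic// setIT lte_mul_pinfty ?lee_fin//.
  exact: lebesgue_itv_lty.
have G1 w : 0 <= w <= 1 -> G w <= C * a ^+ 2.
  move=> /andP[w0 w1]; apply: ler_pM; rewrite ?powR_ge0 ?sqr_ge0//.
    apply: ge0_ler_powR => //; rewrite ?nnegrE ?addr_ge0 ?sqr_ge0//.
    by rewrite lerD2l expr_le1.
  rewrite -(real_normK (num_real (sinc a w))) -(real_normK (num_real a)).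
  by rewrite lerXn2r ?nnegrE// norm_sinc_le.
have G2 w : 1 <= w -> G w <= C * T w.
  move=> w1; have w0 : 0 < w by exact: lt_le_trans w1.
  rewrite /T indicE mem_set/= ?in_itv/= ?w1// mulr1.
  have -> : C * w `^ (- (2 - 2 * kappa)) = ((lam ^+ 2 + 1) * w ^+ 2) `^ kappa * w^-1 ^+ 2.
    rewrite powRM ?addr_ge0 ?sqr_ge0// -mulrA; congr (_ * _).
    rewrite exprVn -powR_mulrn ?ltW// -powRrM -powRN -powRD.
      by congr (_ `^ _); ring.
    by apply/implyP => _; rewrite gt_eqF.
  apply: ler_pM; rewrite ?powR_ge0 ?sqr_ge0//.
    apply: ge0_ler_powR => //; rewrite ?nnegrE.
    - by apply: addr_ge0; exact: sqr_ge0.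
    - by apply: mulr_ge0; [apply: addr_ge0|]; rewrite ?sqr_ge0.
    rewrite mulrDl mul1r lerD2r ler_peMr ?sqr_ge0//.
    by rewrite expr_ge1// ltW.
  rewrite -(real_normK (num_real (sinc a w))) lerXn2r ?nnegrE ?invr_ge0 ?(ltW w0)//.
  by have := norm_sinc_le_inv a w; rewrite (gtr0_norm w0).
have GN w : G (- w) = G w by rewrite /G sincN sqrrN.
have FN w : F (- w) = F w.
  rewrite /F !indicE; suff -> : (- w \in (`[-1, 1]%classic : set R)) =
      (w \in (`[-1, 1]%classic : set R)) by [].
  by rewrite !mem_setE !in_itv/= lerN2 lerNl andbC.
have GFT w : 0 <= w -> G w <= F w + C * T w.
  move=> w0; have [w1|w1] := leP w 1.
    apply: (@le_trans _ _ (F w)); last by rewrite lerDl mulr_ge0.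
    rewrite /F indicE mem_set/= ?mulr1 ?G1 ?w0 ?w1//.
    by rewrite in_itv/= w1 andbT (le_trans _ w0)// lerN10.
  by apply: (le_trans (G2 _ (ltW w1))); rewrite lerDr.
(* [T] lives on [1, +oo[; its reflection covers the negative tail, the integrand being even. *)
apply: (@le_lt_trans _ _ (\int[mu]_w ((F w)%:E + (C%:E * (T w)%:E + C%:E * (T (- w))%:E)))%E).
  apply: ge0_le_integral => //.
  - by move=> w _; exact: G0.
  - exact/measurable_EFinP.
  - apply/measurable_EFinP => /=; apply: measurable_funD => //.
    apply: measurable_funD; apply: measurable_funM => //.
    exact: measurableT_comp.
  - move=> w _; rewrite -!EFinM -!EFinD lee_fin -/(G w).
    have [w0|w0] := leP 0 w.
      by apply: (le_trans (GFT w w0)); rewrite addrA lerDl mulr_ge0.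
    rewrite -GN -FN; apply: (le_trans (GFT (- w) _)); first by rewrite oppr_ge0 ltW.
    by rewrite lerD2l lerDr mulr_ge0.
have mTE : measurable_fun setT (fun w => (T w)%:E) by exact/measurable_EFinP.
have mTNE : measurable_fun setT (fun w => (T (- w))%:E).
  by apply/measurable_EFinP; exact: measurableT_comp.
rewrite ge0_integralD//; last 4 first.
- by move=> w _; rewrite lee_fin.
- exact/measurable_EFinP.
- by move=> w _; rewrite adde_ge0// mule_ge0// lee_fin.
- by apply: emeasurable_funD; apply: emeasurable_funM => //.
rewrite lte_add_pinfty// ge0_integralD//; last 4 first.
- by move=> w _; rewrite mule_ge0// lee_fin.
- by apply: emeasurable_funM => //.
- by move=> w _; rewrite mule_ge0// lee_fin.
- by apply: emeasurable_funM => //.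
rewrite !ge0_integralZl_EFin//; try by move=> w _; rewrite lee_fin.
rewrite (ge0_integral_reflect (F := fun w => (T w)%:E))//.
by rewrite lte_add_pinfty// lte_mul_pinfty// lee_fin.
Qed.

End IntegralEstimates.

(** * Plancherel for step functions *)

Section IntervalTransform.
Context {R : realType}.
Local Notation mu := (@lebesgue_measure R).
Implicit Types (f g : R -> R) (a b c d w x t : R).

Lemma L2_reflect f : L2 f -> L2 (fun x => f (- x)).
Proof.
move=> /L2P[mf fy]; apply/L2P; split; first exact: measurableT_comp.
rewrite (ge0_integral_reflect (F := fun x => ((f x) ^+ 2)%:E))//.
- by apply/measurable_EFinP; exact: measurable_funX.
- by move=> x; rewrite lee_fin sqr_ge0.
Qed.

Lemma sqn_reflect f : L2 f -> sqn (fun x => f (- x)) = sqn f.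
Proof.
move=> Lf; apply: EFin_inj; rewrite !sqn_EFin//; last exact: L2_reflect.
rewrite (ge0_integral_reflect (F := fun x => ((f x) ^+ 2)%:E))//.
- by apply/measurable_EFinP; apply: measurable_funX; exact: L2_measurable.
- by move=> x; rewrite lee_fin sqr_ge0.
Qed.

Definition cas t : R := cos t + sin t.

Lemma continuous_cas : continuous cas.
Proof. by move=> t; apply: cvgD; [exact: continuous_cos|exact: continuous_sin]. Qed.

Lemma measurable_cas : measurable_fun setT cas.
Proof. by apply: continuous_measurable_fun; exact: continuous_cas. Qed.

Lemma norm_cas_le2 t : `|cas t| <= 2.
Proof.
by apply: (le_trans (ler_normD _ _)); apply: lerD; [exact: cos_max|exact: sin_max].
Qed.

Lemma cas_sqrDN t : (cas t) ^+ 2 + (cas (- t)) ^+ 2 = 2.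
Proof. rewrite /cas cosN sinN; have := cos2Dsin2 t; lra. Qed.

(* For [w != 0] this is the integral of [cas (w * x)] over [x] in [a, b]. *)
Definition hitv a b w : R := 2 * cas ((a + b) / 2 * w) * sinc ((b - a) / 2) w.

(** Product-to-sum formulas. The product form of [hitv] gives bounds and the dependence on the
    centre; this difference of endpoint values gives additivity. *)
Lemma hitvE a b w :
  hitv a b w = ((sin (b * w) - cos (b * w)) - (sin (a * w) - cos (a * w))) / w.
Proof.
rewrite /hitv /sinc /cas.
have -> : b * w = (a + b) / 2 * w + (b - a) / 2 * w by field.
have -> : a * w = (a + b) / 2 * w - (b - a) / 2 * w by field.
rewrite sinD cosD sinB cosB; ring.
Qed.

Lemma hitvD a b c w : hitv a b w + hitv b c w = hitv a c w.
Proof. rewrite !hitvE; ring. Qed.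

Lemma hitvv a w : hitv a a w = 0.
Proof. by rewrite hitvE subrr mul0r. Qed.

Lemma hitv_opp a b w : hitv a b w = - hitv b a w.
Proof. by apply/eqP; rewrite -subr_eq0 opprK hitvD hitvv. Qed.

Lemma measurable_hitv a b : measurable_fun setT (hitv a b).
Proof.
apply: measurable_funM; last exact: measurable_sinc.
apply: measurable_funM => //; apply: (measurableT_comp measurable_cas).
exact: measurable_funM.
Qed.

Lemma norm_hitv_le a b w : `|hitv a b w| <= `|4 * sinc ((b - a) / 2) w|.
Proof.
rewrite !normrM ler_wpM2r// !normr_nat.
have := norm_cas_le2 ((a + b) / 2 * w); lra.
Qed.

Lemma L2_sinc a : L2 (sinc a).
Proof.
apply/L2P; split; first exact: measurable_sinc.
(* Exponent 0 makes the weight 1 everywhere, including w = 0 where its base is 0. *)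
have := @integral_weight_sinc R 0 0 a.
under eq_integral do rewrite powRr0 mul1r.
by apply; rewrite lexx invr_gt0 ltr0n.
Qed.

Lemma L2_hitv a b : L2 (hitv a b).
Proof.
apply: (L2_le (measurable_hitv a b) (L2Z 4 (L2_sinc ((b - a) / 2)))).
exact: norm_hitv_le.
Qed.

Lemma integral_weight_hitv (lam kappa a b : R) : 0 <= kappa < 2^-1 ->
  (\int[mu]_w ((lam ^+ 2 + w ^+ 2) `^ kappa * (hitv a b w) ^+ 2)%:E < +oo)%E.
Proof.
move=> k01; have H := @integral_weight_sinc R lam kappa ((b - a) / 2) k01.
have mW : measurable_fun setT (fun w => (lam ^+ 2 + w ^+ 2) `^ kappa).
  apply: (measurableT_comp (measurable_powR _)).
  by apply: measurable_funD => //; exact: measurable_funX.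
have mS : measurable_fun setT
    (fun w => (lam ^+ 2 + w ^+ 2) `^ kappa * (sinc ((b - a) / 2) w) ^+ 2).
  by apply: measurable_funM => //; apply: measurable_funX; exact: measurable_sinc.
apply: (@le_lt_trans _ _ (\int[mu]_w (16%:E *
    ((lam ^+ 2 + w ^+ 2) `^ kappa * (sinc ((b - a) / 2) w) ^+ 2)%:E))%E).
  apply: ge0_le_integral => //.
  - by move=> w _; rewrite lee_fin mulr_ge0 ?powR_ge0 ?sqr_ge0.
  - apply/measurable_EFinP; apply: measurable_funM => //.
    by apply: measurable_funX; exact: measurable_hitv.
  - by apply/measurable_EFinP; exact: measurable_funM.
  - move=> w _; rewrite -EFinM lee_fin [leRHS]mulrCA ler_wpM2l ?powR_ge0//.
    rewrite -(real_normK (num_real (hitv a b w))).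
    have -> : 16 * sinc ((b - a) / 2) w ^+ 2 = `|4 * sinc ((b - a) / 2) w| ^+ 2.
      by rewrite real_normK ?num_real//; ring.
    by rewrite lerXn2r ?nnegrE// norm_hitv_le.
rewrite ge0_integralZl_EFin//.
- by rewrite lte_mul_pinfty// lee_fin.
- by move=> w _; rewrite lee_fin mulr_ge0 ?powR_ge0 ?sqr_ge0.
- exact/measurable_EFinP.
Qed.

(** From sinc a w = a * sinc 1 (a w): squaring gives a^2, and the substitution removes one factor
    a. *)
Lemma sqn_sinc a : 0 <= a -> sqn (sinc a) = a * sqn (sinc 1).
Proof.
rewrite le_eqVlt => /predU1P[<-|a0].
  rewrite mul0r /sqn /L2_inner; under eq_Rintegral do rewrite /sinc !mul0r sin0 !mul0r.
  by rewrite Rintegral_cst// mul0r.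
apply: EFin_inj; rewrite EFinM !sqn_EFin; [|exact: L2_sinc|exact: L2_sinc].
have mS1 : measurable_fun setT (fun w => ((sinc 1 w) ^+ 2)%:E).
  by apply/measurable_EFinP; apply: measurable_funX; exact: measurable_sinc.
rewrite [in RHS](ge0_integral_scale a0)//; last by move=> x; rewrite lee_fin sqr_ge0.
have mS2 : measurable_fun setT (fun w => ((sinc 1 (a * w)) ^+ 2)%:E).
  apply/measurable_EFinP; apply: measurable_funX.
  by apply: (measurableT_comp (measurable_sinc 1)); exact: measurable_funM.
rewrite -!ge0_integralZl_EFin//; try by move=> x _; rewrite lee_fin ?sqr_ge0//.
- apply: eq_integral => w _; rewrite -!EFinM; congr EFin.
  rewrite /sinc mul1r; have [->|w0] := eqVneq w 0.
    by rewrite mulr0 invr0 !mulr0 expr0n !mulr0.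
  by field; rewrite w0 gt_eqF.
- by move=> x _; rewrite mule_ge0// lee_fin ?sqr_ge0// ltW.
- exact: emeasurable_funM.
- exact: ltW.
- exact: ltW.
Qed.

(** Classically 2 pi. The factor 2 arises as 4 * ((b - a) / 2): the mean of cas^2 over w and -w is
    1, so the squared norm of [hitv a b] is 4 times that of [sinc ((b - a) / 2)]. *)
Definition plancherel_const : R := 2 * sqn (sinc 1).

(** A zero norm would make sin w / w vanish almost everywhere, but it is positive on ]0, 1[, which
    has measure 1. *)
Lemma plancherel_const_gt0 : 0 < plancherel_const.
Proof.
rewrite mulr_gt0// lt_neqAle sqn_ge0 andbT eq_sym; apply/negP => /eqP.
move=> /(sqn_eq0 (L2_sinc 1)) /= S0.
have : ({ae mu, forall w, ~ (`]0, 1[%classic : set R) w}).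
  apply: filterS S0 => w /(_ I) + /=; rewrite in_itv/= /sinc mul1r => /eqP + /andP[w0 w1].
  rewrite mulf_eq0 invr_eq0 (gt_eqF w0) orbF => /eqP; apply/eqP; rewrite gt_eqF//.
  by rewrite sin_gt0_pi// w0 (lt_le_trans w1)// (le_trans _ (pi_ge2 _))// ler1n.
move=> [N [mN N0 sub]].
have : (mu `]0%R, 1%R[%classic <= mu N)%E.
  apply: le_measure; rewrite ?inE//.
  by move=> w wi; apply: sub; apply.
by rewrite N0 lebesgue_measure_itv/= lte_fin ltr01 -EFinB lee_fin subr0 ler10.
Qed.

(* The cross term [2 cos sin] of [cas^2] is odd, so symmetrizing removes it. *)
Lemma sqn_hitv a b : sqn (hitv a b) = plancherel_const * `|b - a|.
Proof.
wlog ab : a b / a <= b => [H|].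
  have [|/ltW] := leP a b; first exact: H.
  move=> /H; rewrite distrC => <-.
  have -> : hitv a b = (fun w => (-1) * hitv b a w).
    by apply/funext => w; rewrite hitv_opp mulN1r.
  by rewrite sqnZ ?sqrrN ?expr1n ?mul1r//; exact: L2_hitv.
have Lh := L2_hitv a b; have Lh' := L2_reflect Lh.
have d0 : 0 <= (b - a) / 2 by lra.
have -> : `|b - a| = 2 * ((b - a) / 2) by rewrite ger0_norm ?subr_ge0//; field.
suff : sqn (hitv a b) + sqn (fun w => hitv a b (- w)) = 8 * sqn (sinc ((b - a) / 2)).
  have := sqn_sinc d0; rewrite sqn_reflect// /plancherel_const.
  move: (sqn _) => x; move: (sqn _) => y; nra.
apply: EFin_inj; rewrite EFinD EFinM !sqn_EFin//; last exact: L2_sinc.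
rewrite -ge0_integralD//.
- rewrite -ge0_integralZl_EFin//.
  + apply: eq_integral => w _; rewrite -EFinD -EFinM; congr EFin.
    rewrite /hitv sincN mulrN; have := cas_sqrDN ((a + b) / 2 * w).
    move: (cas _) (cas _) (sinc _ _) => x y z; nra.
  + by move=> w _; rewrite lee_fin sqr_ge0.
  + by apply/measurable_EFinP; apply: measurable_funX; exact: measurable_sinc.
- by move=> w _; rewrite lee_fin sqr_ge0.
- by apply/measurable_EFinP; apply: measurable_funX; exact: measurable_hitv.
- by move=> w _; rewrite lee_fin sqr_ge0.
- by apply/measurable_EFinP; apply: measurable_funX; exact: L2_measurable.
Qed.

(** The indicator of [a, b[ with a sign when b < a, so that additivity holds for endpoints in any
    order, as it does for [hitv]. *)
Definition sitv a b x : R := (x < b)%R%:R - (x < a)%R%:R.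

Lemma sitvD a b c x : sitv a b x + sitv b c x = sitv a c x.
Proof. by rewrite /sitv; ring. Qed.

Lemma sitv_indic a b : a <= b -> sitv a b = \1_(`[a, b[%classic).
Proof.
move=> ab; apply/funext => x; rewrite /sitv indicE mem_setE in_itv/=.
have [xa|ax] := ltP x a; first by rewrite (lt_le_trans xa ab) subrr.
by rewrite subr0.
Qed.

Lemma sitv_opp a b x : sitv a b x = - sitv b a x.
Proof. by rewrite /sitv opprB. Qed.

Lemma L2_sitv a b : L2 (sitv a b).
Proof.
wlog ab : a b / a <= b => [H|].
  have [|/ltW ba] := leP a b; first exact: H.
  have := L2Z (-1) (H _ _ ba); congr L2; apply/funext => x.
  by rewrite [RHS]sitv_opp mulN1r.
rewrite sitv_indic//; apply: L2_indic => //; exact: lebesgue_itv_lty.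
Qed.

Lemma sqn_sitv a b : sqn (sitv a b) = `|b - a|.
Proof.
wlog ab : a b / a <= b => [H|].
  have [|/ltW] := leP a b; first exact: H.
  move=> /H; rewrite distrC => <-.
  have -> : sitv a b = (fun w => (-1) * sitv b a w).
    by apply/funext => w; rewrite sitv_opp mulN1r.
  by rewrite sqnZ ?sqrrN ?expr1n ?mul1r//; exact: L2_sitv.
rewrite sitv_indic// /sqn L2_inner_indic.
transitivity (fine (mu `[a, b[%classic)).
  transitivity (\int[mu]_(x in `[a, b[) (cst 1 x)).
    by apply: eq_Rintegral => x xab; rewrite indicE xab.
  by rewrite Rintegral_cst// mul1r.
rewrite lebesgue_measure_itv/= lte_fin ger0_norm ?subr_ge0//.
by move: ab; rewrite le_eqVlt => /predU1P[->|->]; rewrite ?ltxx ?subrr.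
Qed.

(* Polarization applied to [|d-a| + |c-b| - |c-a| - |d-b|]. *)
Lemma additive_itv_inner (F : R -> R -> R -> R) a b c d : (forall a b, L2 (F a b)) ->
  (forall a b c x, F a b x + F b c x = F a c x) ->
  2 * L2_inner (F a b) (F c d) =
  sqn (F a d) + sqn (F b c) - sqn (F a c) - sqn (F b d).
Proof.
move=> LF FD.
have E1 : F a d = (fun x => 1 * F a b x + 1 * F b d x).
  by apply/funext => x; rewrite !mul1r FD.
have E2 : F a c = (fun x => 1 * F a b x + 1 * F b c x).
  by apply/funext => x; rewrite !mul1r FD.
have E3 : F c d = (fun x => 1 * F b d x + (-1) * F b c x).
  by apply/funext => x; rewrite -(FD b c d); ring.
rewrite E1 E2 E3 !sqn_lin// L2_inner_linr//; lra.
Qed.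

Lemma hitv_inner a b c d :
  L2_inner (hitv a b) (hitv c d) = plancherel_const * L2_inner (sitv a b) (sitv c d).
Proof.
have := additive_itv_inner a b c d L2_hitv hitvD.
have := additive_itv_inner a b c d L2_sitv sitvD.
rewrite !sqn_hitv !sqn_sitv; nra.
Qed.

End IntervalTransform.

(** * Step functions: isometry and density *)

Section StepFunctions.
Context {R : realType}.
Local Notation mu := (@lebesgue_measure R).
Local Notation C := (@plancherel_const R).
Implicit Types (f g : R -> R) (a b w x : R) (s t : seq (R * (R * R))).

Lemma L2_sum (I : Type) (s : seq I) (c : I -> R) (F : I -> R -> R) :
  (forall i, L2 (F i)) -> L2 (fun x => \sum_(i <- s) c i * F i x).
Proof.
move=> LF; elim: s => [|i s IH].
  by under eq_fun do rewrite big_nil; exact: L2_0.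
have := L2_lin (c i) 1 (LF i) IH; congr L2.
by apply/funext => x; rewrite big_cons mul1r.
Qed.

Lemma L2_inner_suml (I : Type) (s : seq I) (c : I -> R) (F : I -> R -> R) g :
  (forall i, L2 (F i)) -> L2 g ->
  L2_inner (fun x => \sum_(i <- s) c i * F i x) g = \sum_(i <- s) c i * L2_inner (F i) g.
Proof.
move=> LF Lg; elim: s => [|i s IH].
  rewrite big_nil /L2_inner; under eq_Rintegral do rewrite big_nil mul0r.
  by rewrite Rintegral_cst// mul0r.
rewrite big_cons -IH -[X in _ + X]mul1r -L2_inner_linl//; last exact: L2_sum.
by congr L2_inner; apply/funext => x; rewrite big_cons mul1r.
Qed.

(** Intervals may overlap and come in any order, so linear combinations are mere concatenations. *)
Definition stepf s x : R := \sum_(p <- s) p.1 * sitv p.2.1 p.2.2 x.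
Definition hstep s w : R := \sum_(p <- s) p.1 * hitv p.2.1 p.2.2 w.

Lemma L2_stepf s : L2 (stepf s).
Proof.
exact: (@L2_sum _ s (fun p => p.1) (fun p => sitv p.2.1 p.2.2) (fun p => L2_sitv _ _)).
Qed.

Lemma L2_hstep s : L2 (hstep s).
Proof.
exact: (@L2_sum _ s (fun p => p.1) (fun p => hitv p.2.1 p.2.2) (fun p => L2_hitv _ _)).
Qed.

Lemma hstep_inner s t :
  L2_inner (hstep s) (hstep t) = C * L2_inner (stepf s) (stepf t).
Proof.
have Lh (p : R * (R * R)) := L2_hitv p.2.1 p.2.2.
have Ls (p : R * (R * R)) := L2_sitv p.2.1 p.2.2.
rewrite (L2_inner_suml s _ Lh (L2_hstep t)) (L2_inner_suml s _ Ls (L2_stepf t)).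
rewrite mulr_sumr; apply: eq_bigr => p _.
rewrite (L2_innerC (hitv _ _)) (L2_innerC (sitv _ _)).
rewrite (L2_inner_suml t _ Lh (Lh p)) (L2_inner_suml t _ Ls (Ls p)).
rewrite mulrCA; congr (_ * _); rewrite mulr_sumr; apply: eq_bigr => q _.
by rewrite hitv_inner mulrCA.
Qed.

Lemma sqn_hstepB s t : sqn (hstep s \- hstep t) = C * sqn (stepf s \- stepf t).
Proof.
rewrite sqnB; [|exact: L2_hstep|exact: L2_hstep].
rewrite sqnB; [|exact: L2_stepf|exact: L2_stepf].
rewrite /sqn !hstep_inner; ring.
Qed.

Lemma stepf_lin a s t : exists u, stepf u = (fun x => a * stepf s x + stepf t x).
Proof.
exists ([seq (a * p.1, p.2) | p <- s] ++ t); apply/funext => x.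
rewrite /stepf big_cat big_map mulr_sumr; congr (_ + _).
by apply: eq_bigr => p _; rewrite mulrA.
Qed.

Lemma sitv_stepf a b : sitv a b = stepf [:: (1, (a, b))].
Proof. by apply/funext => x; rewrite /stepf big_seq1 mul1r. Qed.

Lemma stepf_dense f (eps : R) : L2 f -> 0 < eps -> exists s, sqn (f \- stepf s) < eps.
Proof.
move=> Lf e0.
have [||||_ [s _ <-] H] := @L2_dense_of_orthogonal R (range stepf) _ _ _ _ f Lf eps e0.
- by exists [::] => //; apply/funext => x; rewrite /stepf big_nil.
- by move=> _ [s _ <-]; exact: L2_stepf.
- move=> a _ _ [s _ <-] [t _ <-]; have [u <-] := stepf_lin a s t; by exists u.
- move=> q Lq qorth; apply: L2_orthogonal_itv_eq0 => // a b ab.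
  rewrite -L2_inner_indic -(sitv_indic (ltW ab)).
  by apply: qorth; rewrite sitv_stepf; exists [:: (1, (a, b))].
- by exists s.
Qed.

Lemma stepf_approx f : L2 f -> exists s : nat -> seq (R * (R * R)),
  L2cvg (fun k => stepf (s k)) f.
Proof.
move=> Lf; have e0 (k : nat) : 0 < k.+1%:R^-1 :> R by rewrite invr_gt0.
have /choice[s Hs] := fun k => stepf_dense Lf (e0 k).
exists s; apply: (le_cvg0 (y := fun k => k.+1%:R^-1)); last exact: cvg_harmonic.
by move=> k; rewrite sqn_ge0/= sqnB_sym ltW.
Qed.

End StepFunctions.

(** * Transforms truncated to a window *)

Section TruncatedTransform.
Context {R : realType}.
Local Notation mu := (@lebesgue_measure R).
Local Notation C := (@plancherel_const R).
Implicit Types (f g : R -> R) (a b w x : R) (s t : seq (R * (R * R))) (n : nat).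

(** Half-open, unlike the interval in [fourier_trunc], so that truncating a step function gives a
    step function; the two differ by one point. *)
Definition window n : set R := `[- n%:R, n%:R[%classic.

Definition trunc n f x : R := f x * \1_(window n) x.

Definition cas_trunc n w x : R := cas (w * x) * \1_(window n) x.

Lemma measurable_window n : measurable (window n).
Proof. exact: measurable_itv. Qed.
#[local] Hint Resolve measurable_window : core.

Lemma L2_trunc n f : L2 f -> L2 (trunc n f).
Proof.
move=> Lf; apply: (L2_le _ Lf) => [|x].
  by apply: measurable_funM; [exact: L2_measurable|exact: measurable_indic].
by rewrite normrM ler_piMr// indicE; case: (_ \in _); rewrite ?normr1 ?normr0.
Qed.

Lemma L2_window n : L2 (\1_(window n) : R -> R).
Proof. by apply: L2_indic => //; exact: lebesgue_itv_lty. Qed.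

Lemma L2_cas_trunc n w : L2 (cas_trunc n w).
Proof.
apply: (L2_le _ (L2Z 2 (L2_window n))) => [|x].
  apply: measurable_funM; last exact: measurable_indic.
  by apply: (measurableT_comp measurable_cas); exact: measurable_funM.
rewrite !normrM ler_wpM2r// (ger0_norm (ler0n _ 2)); exact: norm_cas_le2.
Qed.

Lemma trunc_idem n f g : L2_inner f (trunc n g) = L2_inner (trunc n f) (trunc n g).
Proof.
apply: eq_Rintegral => x _; rewrite /trunc indicE.
by case: (_ \in _); rewrite ?mulr1 ?mulr0.
Qed.

(** As an inner product with a truncated kernel, this is L^2-continuous in f for each fixed w. *)
Definition hart0 f n w : R := L2_inner f (cas_trunc n w).

Lemma hart0_trunc f n w : hart0 (trunc n f) n w = hart0 f n w.
Proof. by rewrite /hart0 [RHS](trunc_idem n f (fun x => cas (w * x))). Qed.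

Lemma window_le m n x : (m <= n)%N -> x \in window m -> x \in window n.
Proof.
rewrite -(ler_nat R) !mem_setE !in_itv/= => mn /andP[h1 h2].
by apply/andP; split; lra.
Qed.

Lemma trunc_le m n f : (m <= n)%N -> trunc n (trunc m f) = trunc m f.
Proof.
move=> mn; apply/funext => x; rewrite /trunc !indicE.
have [xm|_] := boolP (x \in window m); last by rewrite mulr0 mul0r.
by rewrite (window_le mn xm) mulr1.
Qed.

Lemma hart0_widen m n f w : (m <= n)%N -> hart0 (trunc m f) n w = hart0 f m w.
Proof.
move=> mn; apply: eq_Rintegral => x _; rewrite /trunc /cas_trunc !indicE.
have [xm|_] := boolP (x \in window m); last by rewrite mulr0 mul0r !mulr0.
by rewrite (window_le mn xm) !mulr1.
Qed.

Lemma is_derive_hitv w x : w != 0 ->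
  is_derive x 1 (fun y => (sin (y * w) - cos (y * w)) / w) (cas (w * x)).
Proof.
move=> w0.
have D : is_derive x 1 (fun y : R => y * w) w.
  by apply: is_derive_eq; rewrite /= ?scaler0 ?add0r; exact: mulr1.
have Ds : is_derive x 1 (fun y : R => sin (y * w)) (w * cos (x * w)).
  by apply: is_derive_eq; rewrite mulrC.
have Dc : is_derive x 1 (fun y : R => cos (y * w)) (w * - sin (x * w)).
  by apply: is_derive_eq; rewrite mulrC.
apply: is_derive_eq.
rewrite /= scaler0 add0r /GRing.scale/= /cas (mulrC w x).
by field.
Qed.

Lemma continuous_cas_mul w : continuous (fun x => cas (w * x)).
Proof.
move=> y; apply: continuous_comp; last exact: continuous_cas.
by apply: cvgM; [exact: cvg_cst|exact: cvg_id].
Qed.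

Lemma integrable_cas a b w : mu.-integrable `[a, b] (EFin \o (fun x => cas (w * x))).
Proof.
apply: continuous_compact_integrable; first exact: segment_compact.
by apply: continuous_subspaceT; exact: continuous_cas_mul.
Qed.

Lemma Rintegral_cas a b w : w != 0 -> a <= b ->
  \int[mu]_(x in `[a, b]) cas (w * x) = hitv a b w.
Proof.
move=> w0; rewrite le_eqVlt => /predU1P[<-|ab].
  by rewrite hitvv set_itv1 Rintegral_set1.
pose F y := (sin (y * w) - cos (y * w)) / w.
have dF (y : R) : is_derive y 1 F (cas (w * y)) by exact: is_derive_hitv.
have cF : continuous F.
  by move=> y; apply/differentiable_continuous/derivable1_diffP; exact: ex_derive.
rewrite /Rintegral (@continuous_FTC2 R (fun x => cas (w * x)) F)//.
- by rewrite -EFinB /= hitvE /F; ring.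
- by apply: continuous_subspaceT; exact: continuous_cas_mul.
- split.
  + by move=> y _; exact: ex_derive.
  + by apply: cvg_at_right_filter; exact: cF.
  + by apply: cvg_at_left_filter; exact: cF.
- by move=> y _; rewrite derive1E; apply: derive_val.
Qed.

(** Truncating an interval clamps its endpoints; an interval outside the window collapses to an
    empty one. *)
Definition clamp n a : R := Num.max (- n%:R) (Num.min a n%:R).

Lemma sitv_trunc n a b x : sitv a b x * \1_(window n) x = sitv (clamp n a) (clamp n b) x.
Proof.
have n0 : 0 <= n%:R :> R by rewrite ler0n.
rewrite /sitv /clamp indicE mem_setE /window in_itv/= !lt_max !lt_min.
have [xn|nx] := leP (- n%:R) x; last by rewrite /= mulr0 subrr.
have [xn'|nx'] := ltP x n%:R; last by rewrite /= !andbF mulr0 subrr.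
by rewrite /= !andbT mulr1.
Qed.

Lemma clamp_bound n a : - n%:R <= clamp n a <= n%:R.
Proof.
have n0 : 0 <= n%:R :> R by rewrite ler0n.
by rewrite /clamp le_max lexx/= ge_max ge_min lexx orbT andbT; lra.
Qed.

(** Splitting at -n reduces to intervals with ordered endpoints, where the integral of [cas] is
    elementary. *)
Lemma hart0_sitv n a b w : w != 0 -> - n%:R <= a <= n%:R -> - n%:R <= b <= n%:R ->
  hart0 (sitv a b) n w = hitv a b w.
Proof.
move=> w0 an bn.
have H c : - n%:R <= c <= n%:R -> hart0 (sitv (- n%:R) c) n w = hitv (- n%:R) c w.
  move=> /andP[c1 c2]; rewrite /hart0 L2_innerC sitv_indic// L2_inner_indic.
  rewrite -Rintegral_cas// -Rintegral_itv_bndo_bndc.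
    apply: eq_Rintegral => x /set_mem; rewrite /= in_itv/= => /andP[x1 x2].
    by rewrite /cas_trunc indicE mem_set ?mulr1// /window/= in_itv/= x1 (lt_le_trans x2).
  apply: (integrableS _ _ _ (@integrable_cas (- n%:R) c w)) => //.
  by move=> x /=; rewrite !in_itv/= => /andP[-> /ltW].
have -> : sitv a b = (fun x => 1 * sitv (- n%:R) b x + (-1) * sitv (- n%:R) a x).
  by apply/funext => x; rewrite -(sitvD (- n%:R) a b); ring.
rewrite /hart0 L2_inner_linl; [|exact: L2_sitv|exact: L2_sitv|exact: L2_cas_trunc].
rewrite -!/(hart0 _ _ _) !H// -(hitvD (- n%:R) a b); ring.
Qed.

Definition clamp_seq n s := [seq (p.1, (clamp n p.2.1, clamp n p.2.2)) | p <- s].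

Lemma stepf_clamp n s : trunc n (stepf s) = stepf (clamp_seq n s).
Proof.
apply/funext => x; rewrite /trunc /stepf mulr_suml big_map.
by apply: eq_bigr => p _; rewrite -mulrA sitv_trunc.
Qed.

Lemma hart0_stepf n s w : w != 0 -> hart0 (stepf s) n w = hstep (clamp_seq n s) w.
Proof.
move=> w0; rewrite -hart0_trunc stepf_clamp /hart0.
rewrite (L2_inner_suml _ _ (fun p => L2_sitv _ _) (L2_cas_trunc n w)).
rewrite /hstep !big_map; apply: eq_bigr => p _; congr (_ * _).
by apply: hart0_sitv; rewrite ?clamp_bound.
Qed.

Lemma ae_neq0 : {ae mu, forall w : R, w != 0}.
Proof.
exists [set 0]; split => //; first exact: lebesgue_measure_set1.
by move=> w /= /negP; rewrite negbK => /eqP.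
Qed.

(** Cutting every function to 0 at the point 0 changes nothing almost everywhere and makes
    convergence hold at all points. *)
Lemma L2cvg_pointwise_neq0 (u : nat -> R -> R) f g : (forall n, L2 (u n)) -> L2 f ->
  L2cvg u f -> (forall w, w != 0 -> u n w @[n --> \oo] --> g w) ->
  L2 g /\ f = g %[ae mu].
Proof.
move=> Lu Lf uf ug.
pose A := ~` [set (0 : R)]; have mA : measurable A by exact: measurableC.
have memA w : (w \in A) = (w != 0).
  apply/idP/idP => [/set_mem/= /eqP//|w0]; apply/mem_set => /=; exact/eqP.
pose cut (h : R -> R) := fun w => h w * \1_A w.
have cutE h : cut h = h %[ae mu].
  by apply: filterS ae_neq0 => w w0 _; rewrite /cut indicE memA w0 mulr1.
have Lcut h : L2 h -> L2 (cut h).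
  move=> Lh; apply: (L2_ae Lh).
    by apply: measurable_funM; [exact: L2_measurable|exact: measurable_indic].
  by apply: filterS (cutE h) => w H Dw; rewrite H.
have Lcu n := Lcut _ (Lu n).
have cuf : L2cvg (fun n => cut (u n)) f.
  rewrite /L2cvg; under eq_fun => n.
    rewrite (sqn_ae (L2B (Lcu n) Lf) (L2B (Lu n) Lf)); last first.
      by apply: filterS (cutE (u n)) => w H Dw /=; rewrite H.
    over.
  exact: uf.
have [|Lcg fcg] := L2cvg_pointwise Lcu Lf cuf (g := cut g).
  move=> w; rewrite /cut indicE memA; case: eqVneq => [_|w0].
    by under eq_fun do rewrite mulr0; rewrite mulr0; exact: cvg_cst.
  by under eq_fun do rewrite mulr1; rewrite mulr1; exact: ug.
have mg : measurable_fun setT g.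
  (* Measurability of g is recovered by restoring its single value at 0. *)
  have -> : g = cut g \+ (fun w => g 0 * \1_[set 0] w).
    apply/funext => w; rewrite /cut /= !indicE memA.
    have [->|w0] := eqVneq w 0; first by rewrite mulr0 mem_set// mulr1 add0r.
    by rewrite mulr1 memNset ?mulr0 ?addr0//=; exact/eqP.
  apply: measurable_funD; first exact: L2_measurable.
  by apply: measurable_funM => //; exact: measurable_indic.
split; first exact: (L2_ae Lcg mg (cutE g)).
by apply: filterS2 fcg (cutE g) => w -> // ->.
Qed.

(** Step functions approximating f, once truncated, have Cauchy transforms by the isometry. Their
    L^2 limit is [hart0 f n] because at each w other than 0 the transforms converge to it by
    continuity of the inner product. *)
Lemma plancherel_trunc f n : L2 f ->
  L2 (hart0 f n) /\ sqn (hart0 f n) = C * sqn (trunc n f).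
Proof.
move=> Lf; have [s sf] := stepf_approx Lf.
pose t k := clamp_seq n (s k).
have tE k : stepf (t k) = trunc n (stepf (s k)) by rewrite stepf_clamp.
have Lt k := L2_stepf (t k); have Ls k := L2_stepf (s k).
have Ltf := L2_trunc n Lf.
have tf : L2cvg (fun k => stepf (t k)) (trunc n f).
  apply: (le_cvg0 (y := fun k => sqn (stepf (s k) \- f))) => // k.
  rewrite sqn_ge0 /=; rewrite -lee_fin !sqn_EFin; [|exact: L2B|exact: L2B].
  apply: ge0_le_integral => //.
  - by move=> x _; rewrite lee_fin sqr_ge0.
  - by apply/measurable_EFinP; apply: measurable_funX; apply: L2_measurable; exact: L2B.
  - by apply/measurable_EFinP; apply: measurable_funX; apply: L2_measurable; exact: L2B.
  - move=> x _; rewrite lee_fin tE /trunc /= -mulrBl exprMn ler_piMr ?sqr_ge0//.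
have Ch : sqn_cauchy (fun k => hstep (t k)).
  have Ct := L2cvg_cauchy Lt Ltf tf.
  move=> e e0; have [N HN] := Ct (e / C) (divr_gt0 e0 plancherel_const_gt0).
  exists N => i j Ni Nj; rewrite sqn_hstepB mulrC -ler_pdivlMr ?plancherel_const_gt0//.
  exact: HN.
have Lh k := L2_hstep (t k).
have [h Lhh hcvg] := L2_complete Lh Ch.
have [|LH hH] := L2cvg_pointwise_neq0 Lh Lhh hcvg (g := hart0 f n).
  move=> w w0; under eq_fun do rewrite -(hart0_stepf n (s _) w0).
  by apply: L2cvg_inner => //; exact: L2_cas_trunc.
split=> //; rewrite -(sqn_ae Lhh LH hH).
apply: (cvg_unique (@Rhausdorff R) (L2cvg_sqn Lh Lhh hcvg)).
have -> : (fun k => sqn (hstep (t k))) = (fun k => C * sqn (stepf (t k))).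
  by apply/funext => k; rewrite /sqn hstep_inner.
by apply: cvg_cstM; exact: L2cvg_sqn.
Qed.

End TruncatedTransform.

(** * The Hartley transform on L^2 *)

Section Hartley.
Context {R : realType}.
Local Notation mu := (@lebesgue_measure R).
Local Notation C := (@plancherel_const R).
Implicit Types (f g h k : R -> R) (a b w x : R) (n m : nat).

Definition hartley_norm : R := (Num.sqrt (2 * pi))^-1.
Local Notation c0 := hartley_norm.

Lemma hartley_norm_gt0 : 0 < c0.
Proof. by rewrite invr_gt0 sqrtr_gt0 mulr_gt0// pi_gt0. Qed.

Definition hart f n w : R := c0 * hart0 f n w.

Definition is_hartley f h := [/\ L2 f, L2 h & L2cvg (hart f) h].

Lemma L2_hart f n : L2 f -> L2 (hart f n).
Proof. by move=> Lf; apply: L2Z; exact: (plancherel_trunc n Lf).1. Qed.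

Lemma trunc_cvg f : L2 f -> L2cvg (fun n => trunc n f) f.
Proof.
move=> Lf; have Lt n := L2_trunc n Lf.
have mB n : measurable_fun setT (fun x => (((trunc n f \- f) x) ^+ 2)%:E).
  by apply/measurable_EFinP; apply: measurable_funX; apply: L2_measurable; exact: L2B.
have := @dominated_convergence _ _ _ mu setT measurableT
  (fun n x => (((trunc n f \- f) x) ^+ 2)%:E) (cst 0%E) (fun x => ((f x) ^+ 2)%:E) mB.
case=> //.
- apply: aeW => x _; apply: cvg_near_cst.
  have [N _ HN] := nbhs_infty_gtr `|x|.
  exists N => // n /= Nn; congr EFin; rewrite /trunc indicE mem_set ?mulr1 ?subrr ?expr0n//.
  have := HN n Nn; rewrite ltr_norml => /andP[xl xr].
  by rewrite /window/= in_itv/= xr ltW.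
- exact: Lfun2_integrable_sqr.
- apply: aeW => x n _; rewrite /= lee_fin ger0_norm ?sqr_ge0// /trunc indicE.
  case: (_ \in _); first by rewrite mulr1 subrr expr0n sqr_ge0.
  by rewrite mulr0 sub0r sqrrN.
move=> _ _; rewrite integral0 => H.
have : ((sqn (trunc n f \- f))%:E @[n --> \oo] --> 0%:E).
  have -> : (fun n => (sqn (trunc n f \- f))%:E) =
      (fun n => \int[mu]_x (((trunc n f \- f) x) ^+ 2)%:E)%E.
    by apply/funext => n; rewrite sqn_EFin//; exact: L2B.
  exact: H.
by move=> /fine_cvgP[].
Qed.

(** Both transforms can be taken over the larger window, where the difference is the transform of a
    single function. *)
Lemma sqn_hart0B f m n : L2 f ->
  sqn (hart0 f m \- hart0 f n) = C * sqn (trunc m f \- trunc n f).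
Proof.
move=> Lf; pose N := maxn m n.
have Lm := L2_trunc m Lf; have Ln := L2_trunc n Lf.
have -> : hart0 f m \- hart0 f n = hart0 (trunc m f \- trunc n f) N.
  apply/funext => w; rewrite /= -(hart0_widen f w (leq_maxl m n)).
  rewrite -(hart0_widen f w (leq_maxr m n)) /hart0 L2_innerBl//.
  exact: L2_cas_trunc.
rewrite (plancherel_trunc N (L2B Lm Ln)).2; congr (_ * sqn _).
apply/funext => x; rewrite -[in RHS](trunc_le f (leq_maxl m n)).
rewrite -[in RHS](trunc_le f (leq_maxr m n)).
by rewrite [LHS]/trunc /= mulrBl.
Qed.

Lemma is_hartley_exists f : L2 f -> exists h, is_hartley f h.
Proof.
move=> Lf; have Lt n := L2_trunc n Lf.
have [|h Lh fh] := L2_complete (fun n => L2_hart n Lf).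
  have cc : 0 < c0 ^+ 2 * C.
    by rewrite mulr_gt0 ?exprn_gt0 ?hartley_norm_gt0 ?plancherel_const_gt0.
  move=> e e0; have [N HN] := L2cvg_cauchy Lt Lf (trunc_cvg Lf) (divr_gt0 e0 cc).
  exists N => m n Nm Nn.
  have -> : hart f m \- hart f n = (fun w => c0 * (hart0 f m \- hart0 f n) w).
    by apply/funext => w; rewrite /hart /=; ring.
  rewrite sqnZ; last by apply: L2B; exact: (plancherel_trunc _ Lf).1.
  by rewrite sqn_hart0B// mulrA mulrC -ler_pdivlMr// HN.
by exists h.
Qed.

(** Equal to 1 once [plancherel_const] is known to be 2 pi; kept symbolic. *)
Definition hartley_const : R := c0 ^+ 2 * C.
Local Notation C' := hartley_const.

Lemma hartley_const_gt0 : 0 < C'.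
Proof. by rewrite mulr_gt0 ?exprn_gt0 ?hartley_norm_gt0 ?plancherel_const_gt0. Qed.

Lemma is_hartley_sqn f h : is_hartley f h -> sqn h = C' * sqn f.
Proof.
move=> [Lf Lh fh]; have Lt n := L2_trunc n Lf.
apply: (cvg_unique (@Rhausdorff R) (L2cvg_sqn (fun n => L2_hart n Lf) Lh fh)).
have -> : (fun n => sqn (hart f n)) = (fun n => C' * sqn (trunc n f)).
  apply/funext => n; rewrite /hart sqnZ; last exact: (plancherel_trunc _ Lf).1.
  by rewrite (plancherel_trunc _ Lf).2 mulrA.
by apply: cvg_cstM; apply: L2cvg_sqn => //; exact: trunc_cvg.
Qed.

Lemma is_hartley_lin a b f g h k : is_hartley f h -> is_hartley g k ->
  is_hartley (fun x => a * f x + b * g x) (fun w => a * h w + b * k w).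
Proof.
move=> [Lf Lh fh] [Lg Lk gk]; split; [exact: L2_lin|exact: L2_lin|].
have -> : hart (fun x => a * f x + b * g x) = (fun n w => a * hart f n w + b * hart g n w).
  apply/funext => n; apply/funext => w; rewrite /hart /hart0 L2_inner_linl//.
    by ring.
  exact: L2_cas_trunc.
by apply: L2cvg_lin => // n; exact: L2_hart.
Qed.

Lemma is_hartleyB f g h k : is_hartley f h -> is_hartley g k ->
  is_hartley (f \- g) (h \- k).
Proof.
move=> fh gk; have := is_hartley_lin 1 (-1) fh gk.
by congr is_hartley; apply/funext => x /=; ring.
Qed.

Lemma is_hartley0 : is_hartley (cst 0) (cst 0).
Proof.
have E u : u \- u = cst 0 :> (R -> R) by apply/funext => x; rewrite /= subrr.
by have [h h0] := is_hartley_exists (@L2_0 R); have := is_hartleyB h0 h0; rewrite !E.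
Qed.

Lemma is_hartley_unique f h k : is_hartley f h -> is_hartley f k -> h = k %[ae mu].
Proof.
by move=> [Lf Lh fh] [_ Lk fk]; apply: L2cvg_unique fh fk => // n; exact: L2_hart.
Qed.

Lemma is_hartley_aer f h k : is_hartley f h -> L2 k -> h = k %[ae mu] -> is_hartley f k.
Proof.
move=> [Lf Lh fh] Lk hk; split=> //; apply: L2cvg_ae_r fh => // n; exact: L2_hart.
Qed.

Lemma is_hartley_ael f g h : is_hartley f h -> measurable_fun setT g ->
  f = g %[ae mu] -> is_hartley g h.
Proof.
move=> [Lf Lh fh] mg fg; have Lg := L2_ae Lf mg fg.
split; [exact: Lg|exact: Lh|].
suff -> : hart g = hart f by [].
apply/funext => n; apply/funext => w; congr (_ * _).
apply: L2_inner_ae => //; [exact: L2_cas_trunc|exact: L2_cas_trunc| |].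
- by apply: filterS fg => x H Dx; rewrite H.
- exact: aeW.
Qed.

Lemma is_hartley_inner f g h k : is_hartley f h -> is_hartley g k ->
  L2_inner h k = C' * L2_inner f g.
Proof.
move=> fh gk; have := is_hartley_sqn (is_hartleyB fh gk).
have [Lf Lh _] := fh; have [Lg Lk _] := gk.
rewrite !sqnB// (is_hartley_sqn fh) (is_hartley_sqn gk); lra.
Qed.

(** Truncated L^2 functions are in L^1 and |cas| <= 2, so the double integral converges absolutely;
    the kernel is symmetric in x and w. *)
Lemma hart0_fubini f g m n : L2 f -> L2 g ->
  L2_inner (hart0 f m) (trunc n g) = L2_inner (trunc m f) (hart0 g n).
Proof.
move=> Lf Lg.
pose F := trunc m f; pose G := trunc n g.
have LF : L2 F by exact: L2_trunc. have LG : L2 G by exact: L2_trunc.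
have trunc_int j (h : R -> R) : L2 h -> (\int[mu]_x `|trunc j h x|%:E < +oo)%E.
  by move=> Lh; have /integrableP[] := L2_mulr_integrable Lh (L2_window j).
pose K (p : R * R) : \bar R := (F p.1 * G p.2 * cas (p.2 * p.1))%:E.
have mK : measurable_fun setT K.
  apply/measurable_EFinP; apply: measurable_funM; first apply: measurable_funM.
  - by apply: measurableT_comp; [exact: L2_measurable|exact: measurable_fst].
  - by apply: measurableT_comp; [exact: L2_measurable|exact: measurable_snd].
  - apply: (measurableT_comp measurable_cas); apply: measurable_funM.
      exact: measurable_snd.
    exact: measurable_fst.
have mFn : measurable_fun setT (fun x => `|F x|%:E).
  by apply/measurable_EFinP; apply: measurableT_comp => //; exact: L2_measurable.
have mGn : measurable_fun setT (fun x => `|G x|%:E).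
  by apply/measurable_EFinP; apply: measurableT_comp => //; exact: L2_measurable.
have iK : (mu \x mu)%E.-integrable setT K.
  apply/integrable12ltyP; first exact: mK.
  apply: (@le_lt_trans _ _ (\int[mu]_x (2 * `|F x|)%:E * \int[mu]_x `|G x|%:E)%E).
    rewrite -ge0_integralZr//; last 2 first.
    - by apply/measurable_EFinP; apply: measurable_funM => //; exact/measurable_EFinP.
    - by apply: integral_ge0 => x _; rewrite lee_fin.
    apply: ge0_le_integral => //.
    - by move=> x _; exact: integral_ge0.
    - apply: (@measurable_fun_fubini_tonelli_F _ _ _ _ _ mu (abse \o K)).
        exact: measurableT_comp.
      by move=> p; exact: abse_ge0.
    - apply: emeasurable_funM => //; apply/measurable_EFinP.
      by apply: measurable_funM => //; exact/measurable_EFinP.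
    - move=> x _; rewrite -ge0_integralZl_EFin ?mulr_ge0//.
      apply: ge0_le_integral => //.
      + by apply: measurableT_comp => //; exact: measurableT_comp mK (measurable_pair1 _).
      + by apply: emeasurable_funM.
      + move=> w _; rewrite /K /= -EFinM lee_fin !normrM mulrC -[leRHS]mulrA.
        by rewrite ler_wpM2r ?mulr_ge0 ?norm_cas_le2.
  under eq_integral do rewrite EFinM.
  rewrite ge0_integralZl_EFin//.
  have F0 : (0 <= \int[mu]_x `|F x|%:E)%E by exact: integral_ge0.
  have F_fin : (\int[mu]_x `|F x|%:E)%E \is a fin_num.
    by rewrite ge0_fin_numE//; exact: trunc_int.
  by rewrite lte_mul_pinfty// ?mule_ge0 ?fin_numM//; exact: trunc_int.
have := @Fubini _ _ _ _ _ mu mu K iK.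
have E1 w : (\int[mu]_x K (x, w) = (hart0 f m w * G w)%:E)%E.
  rewrite mulrC EFinM L2_inner_EFin//; last exact: L2_cas_trunc.
  rewrite -integralZl//; last by apply: L2_mulr_integrable => //; exact: L2_cas_trunc.
  apply: eq_integral => x _; rewrite -EFinM; congr EFin.
  by rewrite /F /trunc /cas_trunc; ring.
have E2 x : (\int[mu]_w K (x, w) = (F x * hart0 g n x)%:E)%E.
  rewrite EFinM L2_inner_EFin//; last exact: L2_cas_trunc.
  rewrite -integralZl//; last by apply: L2_mulr_integrable => //; exact: L2_cas_trunc.
  apply: eq_integral => w _; rewrite -EFinM; congr EFin.
  by rewrite /G /trunc /cas_trunc /= (mulrC x); ring.
under eq_integral do rewrite E2.
under [RHS]eq_integral do rewrite E1.
move=> E; apply: EFin_inj; rewrite !L2_inner_EFin//.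
- exact: (plancherel_trunc _ Lg).1.
- exact: (plancherel_trunc _ Lf).1.
Qed.

Lemma is_hartley_sym f g h k : is_hartley f h -> is_hartley g k ->
  L2_inner h g = L2_inner f k.
Proof.
move=> [Lf Lh fh] [Lg Lk gk].
have Ltf n := L2_trunc n Lf; have Ltg n := L2_trunc n Lg.
have Lhf n := L2_hart n Lf; have Lhg n := L2_hart n Lg.
have E m n : L2_inner (hart f m) (trunc n g) = L2_inner (trunc m f) (hart g n).
  have E0 := hart0_fubini m n Lf Lg.
  rewrite /hart; have := L2_inner_linl c0 0 (plancherel_trunc m Lf).1 L2_0 (Ltg n).
  under eq_fun do rewrite mulr0 addr0; move=> ->; rewrite mul0r addr0.
  have := L2_inner_linr c0 0 (plancherel_trunc n Lg).1 L2_0 (Ltf m).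
  under eq_fun do rewrite mulr0 addr0; move=> ->; rewrite mul0r addr0.
  by rewrite E0.
(* The limit in m is taken with n fixed, then the limit in n, so each passage has a fixed test
   function. *)
have En n : L2_inner h (trunc n g) = L2_inner f (hart g n).
  apply: (cvg_unique (@Rhausdorff R) (L2cvg_inner Lhf Lh (Ltg n) fh)).
  have -> : (fun m => L2_inner (hart f m) (trunc n g)) =
      (fun m => L2_inner (trunc m f) (hart g n)) by apply/funext => m; exact: E.
  by apply: L2cvg_inner => //; exact: trunc_cvg.
rewrite [LHS]L2_innerC [RHS]L2_innerC.
apply: (cvg_unique (@Rhausdorff R) (L2cvg_inner Ltg Lg Lh (trunc_cvg Lg))).
have -> : (fun n => L2_inner (trunc n g) h) = (fun n => L2_inner (hart g n) f).
  by apply/funext => n; rewrite L2_innerC En L2_innerC.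
exact: L2cvg_inner.
Qed.

(** Testing against d = g - C' f itself: symmetry and then the isometry turn <g, d> into C' <f, d>,
    so d is orthogonal to itself. *)
Lemma is_hartley_inv f h g : is_hartley f h -> is_hartley h g ->
  g = (fun x => C' * f x) %[ae mu].
Proof.
move=> fh hg; have [Lf Lh _] := fh; have [_ Lg _] := hg.
have LCf := L2Z C' Lf; have Ld := L2B Lg LCf.
apply: sqnB_eq0 => //; rewrite {1}/sqn.
have [k dk] := is_hartley_exists Ld.
rewrite L2_innerBl// (is_hartley_sym hg dk) (is_hartley_inner fh dk).
have := L2_inner_linl C' 0 Lf L2_0 Ld.
by under eq_fun do rewrite mulr0 addr0; move=> ->; rewrite mul0r addr0 subrr.
Qed.

Lemma is_hartley_surj h : L2 h -> exists f, is_hartley f h.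
Proof.
move=> Lh; have [f hf] := is_hartley_exists Lh; have [_ Lf _] := hf.
have [g fg] := is_hartley_exists Lf.
have Cn0 : C' != 0 by rewrite gt_eqF// hartley_const_gt0.
(* The preimage is the transform of h divided by C'; the null term only gives it the shape of
   [is_hartley_lin]. *)
exists (fun x => C'^-1 * f x + 0 * f x).
apply: (is_hartley_aer (is_hartley_lin _ _ fg fg)) => //.
apply: filterS (is_hartley_inv hf fg) => x -> // _.
by rewrite mul0r addr0 mulrA mulVf// mul1r.
Qed.

Lemma is_hartley_inj f g h k : is_hartley f h -> is_hartley g k ->
  h = k %[ae mu] -> f = g %[ae mu].
Proof.
move=> fh gk hk; have [Lf Lh _] := fh; have [Lg Lk _] := gk.
apply: sqnB_eq0 => //; have := is_hartley_sqn (is_hartleyB fh gk).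
rewrite sqnB_ae0// => /esym/eqP; rewrite mulf_eq0 gt_eqF ?hartley_const_gt0//=.
by move/eqP.
Qed.

End Hartley.

(** * Fourier and Hartley transforms *)

Section FourierHartley.
Local Open Scope complex_scope.
Context {R : realType}.
Local Notation mu := (@lebesgue_measure R).
Local Notation Re := (@complex.Re R).
Local Notation Im := (@complex.Im R).
Implicit Types (f h k u v phi : R -> R) (g : R -> R[i]) (w x : R) (n m : nat).

(* The transform of a real function is Hermitian; [of_hartley] is the bijection
   from real functions [h] to Hermitian functions [g] inverse to [Re g - Im g]. *)
Definition of_hartley h w : R[i] := ((h w + h (- w)) / 2) +i* ((h (- w) - h w) / 2).

Lemma sqnormc_of_hartley h w : sqnormc (of_hartley h w) = (h w ^+ 2 + h (- w) ^+ 2) / 2.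
Proof. by rewrite /sqnormc /=; field. Qed.

Lemma of_hartleyB h k w : of_hartley h w - of_hartley k w = of_hartley (h \- k) w.
Proof. by rewrite /of_hartley; congr (_ +i* _) => /=; field. Qed.

Lemma L2C_of_hartley h : L2 h -> L2C (of_hartley h).
Proof.
move=> Lh; have Lh' := L2_reflect Lh; split.
- rewrite (_ : (fun w => _) = (fun w => 2^-1 * h w + 2^-1 * h (- w))); first exact: L2_lin.
  by apply/funext => w /=; field.
- rewrite (_ : (fun w => _) = (fun w => - 2^-1 * h w + 2^-1 * h (- w))); first exact: L2_lin.
  by apply/funext => w /=; field.
Qed.

Lemma integral_sqnormc_of_hartley h : L2 h ->
  (\int[mu]_w (sqnormc (of_hartley h w))%:E)%E = (sqn h)%:E.
Proof.
move=> Lh; have Lh' := L2_reflect Lh.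
have mh2 : measurable_fun setT (fun w => (h w ^+ 2)%:E).
  by apply/measurable_EFinP; apply: measurable_funX; exact: L2_measurable.
have mh2' : measurable_fun setT (fun w => (h (- w) ^+ 2)%:E).
  by apply/measurable_EFinP; apply: measurable_funX; exact: (L2_measurable Lh').
under eq_integral do rewrite sqnormc_of_hartley mulrC EFinM EFinD.
rewrite ge0_integralZl_EFin//; last 2 first.
- by move=> w _; rewrite adde_ge0// lee_fin sqr_ge0.
- exact: emeasurable_funD.
rewrite ge0_integralD//; last 2 first.
- by move=> w _; rewrite lee_fin sqr_ge0.
- by move=> w _; rewrite lee_fin sqr_ge0.
rewrite -(sqn_EFin Lh) -(sqn_EFin Lh') sqn_reflect// -EFinD -EFinM; congr EFin; lra.
Qed.

Lemma L2_mul_bounded f (b : R -> R) : L2 f -> measurable_fun setT b ->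
  (forall x, `|b x| <= 1) -> L2 (fun x => f x * b x).
Proof.
move=> Lf mb b1; apply: (L2_le _ Lf) => [|x].
  by apply: measurable_funM => //; exact: L2_measurable.
by rewrite normrM ler_piMr.
Qed.

(** The cosine integral c is even in w and the sine integral s is odd, so the Hartley values at w
    and -w are c + s and c - s, from which c - i s is recovered. *)
Lemma fourier_truncE f n w : L2 f -> fourier_trunc f n w = of_hartley (hart f n) w.
Proof.
move=> Lf.
pose c := \int[mu]_(x in `[- n%:R, n%:R]) (f x * cos (w * x)).
pose s := \int[mu]_(x in `[- n%:R, n%:R]) (f x * sin (w * x)).
have mw (z : R) : measurable_fun setT (fun x : R => z * x) by exact: measurable_funM.
have Lc (z : R) : L2 (fun x => f x * cos (z * x)).
  apply: L2_mul_bounded => // [|x]; last exact: cos_max.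
  by apply: (measurableT_comp _ (mw z)); apply: continuous_measurable_fun; exact: continuous_cos.
have Ls (z : R) : L2 (fun x => f x * sin (z * x)).
  apply: L2_mul_bounded => // [|x]; last exact: sin_max.
  by apply: (measurableT_comp _ (mw z)); apply: continuous_measurable_fun; exact: continuous_sin.
have int_on (b1 : bool) u : L2 u ->
    mu.-integrable [set` Interval (BLeft (- n%:R)) (BSide b1 n%:R)] (EFin \o u).
  by move=> Lu; apply: L2_integrable_on => //; exact: lebesgue_itv_lty.
have hartE (z : R) : hart0 f n z =
    \int[mu]_(x in `[- n%:R, n%:R]) (f x * cos (z * x)) +
    \int[mu]_(x in `[- n%:R, n%:R]) (f x * sin (z * x)).
  rewrite -RintegralD//; [|exact: int_on|exact: int_on].
  rewrite -Rintegral_itv_bndo_bndc; last exact: (int_on true _ (L2D (Lc z) (Ls z))).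
  rewrite [RHS]Rintegral_mkcond; apply: eq_Rintegral => x _.
  rewrite /cas_trunc patchE indicE /window /cas.
  by case: ifPn => _; rewrite ?mulr1 ?mulr0//; ring.
have hE : hart0 f n w = c + s by rewrite hartE.
have hNE : hart0 f n (- w) = c - s.
  rewrite hartE; congr (_ + _).
    by apply: eq_Rintegral => x _; rewrite mulNr cosN.
  rewrite -[RHS]mulN1r -RintegralZl//; last exact: int_on.
  by apply: eq_Rintegral => x _; rewrite mulNr sinN; ring.
have cE : \int[mu]_(x in `[- n%:R, n%:R]) Re ((f x)%:C * expi (- (w * x))) = c.
  by apply: eq_Rintegral => x _; rewrite /= cosN; ring.
have sE : \int[mu]_(x in `[- n%:R, n%:R]) Im ((f x)%:C * expi (- (w * x))) = - s.
  rewrite -[RHS]mulN1r -RintegralZl//; last exact: int_on.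
  by apply: eq_Rintegral => x _; rewrite /= sinN; ring.
rewrite /fourier_trunc /cintegral cE sE /of_hartley /hart hE hNE.
by rewrite -/(hartley_norm); congr (_ +i* _) => /=; field.
Qed.

Lemma is_fourier_of_hartley f h : is_hartley f h -> is_fourier f (of_hartley h).
Proof.
move=> [Lf Lh fh]; split=> //; first exact: L2C_of_hartley.
have -> : (fun n => \int[mu]_w (sqnormc (fourier_trunc f n w - of_hartley h w))%:E)%E =
    (fun n => (sqn (hart f n \- h))%:E).
  apply/funext => n; under eq_integral do rewrite fourier_truncE// of_hartleyB.
  by rewrite integral_sqnormc_of_hartley//; apply: L2B => //; exact: L2_hart.
by apply: cvg_EFin => //; exact: nearW.
Qed.

(** Used with p equal to Re, Im and Re - Im; the factor 2 is the best constant for the last one. *)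
Lemma is_fourier_L2cvg (p : R[i] -> R) f g :
  (forall z z', p (z - z') = p z - p z') ->
  (forall z, p z ^+ 2 <= 2 * sqnormc z) ->
  (forall n, L2 (fun w => p (fourier_trunc f n w))) -> L2 (fun w => p (g w)) ->
  is_fourier f g ->
  L2cvg (fun n w => p (fourier_trunc f n w)) (fun w => p (g w)).
Proof.
move=> pB p_le Lp Lpg [Lf [Lgr Lgi] fg].
suff H : ((sqn ((fun w => p (fourier_trunc f n w)) \- (fun w => p (g w))))%:E
    @[n --> \oo] --> 0%:E) by move/fine_cvgP: H => [].
pose I n := (\int[mu]_w (sqnormc (fourier_trunc f n w - g w))%:E)%E.
have I2 : (2%:E * I n)%E @[n --> \oo] --> 0%E.
  by rewrite -[X in _ --> X](mule0 2%:E); apply: cvgeZl.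
apply: (squeeze_cvge (f := cst 0%E) (h := fun n => (2%:E * I n)%E)) => //; last exact: cvg_cst.
apply: nearW => n; rewrite lee_fin sqn_ge0/= sqn_EFin; last exact: L2B.
have Lh := L2_hart n Lf.
have mS : measurable_fun setT (fun w => (sqnormc (fourier_trunc f n w - g w))%:E).
  have [Lr Li] := L2C_of_hartley Lh.
  have -> : (fun w => (sqnormc (fourier_trunc f n w - g w))%:E) = (fun w =>
      (((Re (of_hartley (hart f n) w) - Re (g w)) ^+ 2 +
       (Im (of_hartley (hart f n) w) - Im (g w)) ^+ 2)%R)%:E).
    apply/funext => w; rewrite fourier_truncE// /sqnormc.
    by case: (g w) => a b.
  apply/measurable_EFinP; apply: measurable_funD; apply: measurable_funX;
    by apply: L2_measurable; exact: L2B.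
rewrite /I -ge0_integralZl_EFin//; last first.
  by move=> w _; rewrite lee_fin addr_ge0 ?sqr_ge0.
apply: ge0_le_integral => //.
- by move=> w _; rewrite lee_fin sqr_ge0.
- by apply/measurable_EFinP; apply: measurable_funX; apply: L2_measurable; exact: L2B.
- exact: emeasurable_funM.
- by move=> w _; rewrite -EFinM lee_fin /= -pB.
Qed.

Lemma is_fourier_hartley f g : is_fourier f g ->
  is_hartley f (fun w => Re (g w) - Im (g w)).
Proof.
move=> fg; have [Lf [Lr Li] _] := fg.
have Lg : L2 (fun w => Re (g w) - Im (g w)) by exact: L2B.
split => //.
have hE n : hart f n = (fun w => Re (fourier_trunc f n w) - Im (fourier_trunc f n w)).
  by apply/funext => w; rewrite fourier_truncE//=; field.
have -> : hart f = (fun n w => Re (fourier_trunc f n w) - Im (fourier_trunc f n w)).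
  by apply/funext => n; exact: hE.
apply: (is_fourier_L2cvg (p := fun z => Re z - Im z)) => //.
- by move=> [a b] [a' b'] /=; ring.
- by move=> [a b]; rewrite /sqnormc /=; have := sqr_ge0 (a + b); lra.
- by move=> n; rewrite -hE; exact: L2_hart.
Qed.

Lemma is_fourier_unique f g g' : is_fourier f g -> is_fourier f g' -> g = g' %[ae mu].
Proof.
move=> fg fg'; have [Lf [Lr Li] _] := fg; have [_ [Lr' Li'] _] := fg'.
have LF n : L2C (fourier_trunc f n).
  have -> : fourier_trunc f n = of_hartley (hart f n).
    by apply/funext => w; exact: fourier_truncE.
  by apply: L2C_of_hartley; exact: L2_hart.
have LRe n := (LF n).1; have LIm n := (LF n).2.
have Re_cvg g0 : is_fourier f g0 ->
    L2cvg (fun n w => Re (fourier_trunc f n w)) (fun w => Re (g0 w)).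
  move=> fg0; have [_ [? ?] _] := fg0; apply: is_fourier_L2cvg => //.
  - by move=> [a b] [a' b'].
  - by move=> [a b]; rewrite /sqnormc /=; have := sqr_ge0 a; have := sqr_ge0 b; lra.
have Im_cvg g0 : is_fourier f g0 ->
    L2cvg (fun n w => Im (fourier_trunc f n w)) (fun w => Im (g0 w)).
  move=> fg0; have [_ [? ?] _] := fg0; apply: is_fourier_L2cvg => //.
  - by move=> [a b] [a' b'].
  - by move=> [a b]; rewrite /sqnormc /=; have := sqr_ge0 a; have := sqr_ge0 b; lra.
have Er := L2cvg_unique LRe Lr Lr' (Re_cvg _ fg) (Re_cvg _ fg').
have Ei := L2cvg_unique LIm Li Li' (Im_cvg _ fg) (Im_cvg _ fg').
apply: filterS2 Er Ei => w /(_ I) Er /(_ I) Ei _.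
by move: Er Ei; case: (g w) (g' w) => [a b] [a' b'] /= -> ->.
Qed.

(** Here g is an arbitrary representative, so its symmetry holds only almost everywhere and is
    derived from uniqueness. *)
Lemma is_fourier_hermitian f g : is_fourier f g ->
  g = of_hartley (fun w => Re (g w) - Im (g w)) %[ae mu].
Proof.
move=> fg; apply: (is_fourier_unique fg).
by apply: is_fourier_of_hartley; exact: is_fourier_hartley.
Qed.

End FourierHartley.

(** * The tempered derivative as a multiplier *)

Section Rotation.
Context {R : realType}.
Local Notation mu := (@lebesgue_measure R).
Implicit Types (f h k u v : R -> R) (w x : R).

Variables (th : R -> R) (mth : measurable_fun setT th) (thN : forall w, th (- w) = - th w).

(** Multiplication of a Hermitian function by exp (i th w), th odd, read on the Hartley side. *)
Definition rot h w : R := cos (th w) * h w - sin (th w) * h (- w).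

Lemma measurable_rot h : measurable_fun setT h -> measurable_fun setT (rot h).
Proof.
move=> mh; have mh' : measurable_fun setT (fun w => h (- w)) by exact: measurableT_comp.
have mc := measurableT_comp (continuous_measurable_fun (@continuous_cos R)) mth.
have ms := measurableT_comp (continuous_measurable_fun (@continuous_sin R)) mth.
exact: measurable_funB (measurable_funM mc mh) (measurable_funM ms mh').
Qed.

Lemma L2_rot h : L2 h -> L2 (rot h).
Proof.
move=> Lh; apply: L2B.
- have := L2_mul_bounded Lh (measurableT_comp (continuous_measurable_fun (@continuous_cos R)) mth).
  move=> /(_ (fun x => cos_max _)).
  by congr L2; apply/funext => w /=; rewrite mulrC.
- have := L2_mul_bounded (L2_reflect Lh)
    (measurableT_comp (continuous_measurable_fun (@continuous_sin R)) mth).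
  move=> /(_ (fun x => sin_max _)).
  by congr L2; apply/funext => w /=; rewrite mulrC.
Qed.

Lemma rotB h k : rot (h \- k) = rot h \- rot k.
Proof. by apply/funext => w; rewrite /rot /=; ring. Qed.

(* The rotation mixes the values at [w] and [-w], hence preserves
   [h w ^+ 2 + h (- w) ^+ 2]. *)
Lemma sqn_rot h : L2 h -> sqn (rot h) = sqn h.
Proof.
move=> Lh; have Lr := L2_rot Lh.
have sqnE u : L2 u ->
    (\int[mu]_w (u w ^+ 2 + u (- w) ^+ 2)%:E = (2 * sqn u)%:E)%E.
  move=> Lu; under eq_integral do rewrite EFinD.
  rewrite ge0_integralD//.
  - rewrite -(sqn_EFin Lu) -(sqn_EFin (L2_reflect Lu)) sqn_reflect// -EFinD.
    by congr EFin; ring.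
  - by move=> w _; rewrite lee_fin sqr_ge0.
  - by apply/measurable_EFinP; apply: measurable_funX; exact: L2_measurable.
  - by move=> w _; rewrite lee_fin sqr_ge0.
  - apply/measurable_EFinP; apply: measurable_funX; exact: (L2_measurable (L2_reflect Lu)).
suff : (2 * sqn (rot h))%:E = (2 * sqn h)%:E by case; lra.
rewrite -!sqnE//; apply: eq_integral => w _; congr EFin.
rewrite /rot thN cosN sinN opprK; have := cos2Dsin2 (th w).
move: (cos _) (sin _) (h w) (h (- w)) => c s a b E.
have -> : (c * a - s * b) ^+ 2 + (c * b - - s * a) ^+ 2 =
    (c ^+ 2 + s ^+ 2) * (a ^+ 2 + b ^+ 2) by ring.
by rewrite E mul1r.
Qed.

(** [rot] also reads the value at -w; the isometry dispenses with reflecting the exceptional null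
    set. *)
Lemma rot_ae h k : L2 h -> L2 k -> h = k %[ae mu] -> rot h = rot k %[ae mu].
Proof.
move=> Lh Lk hk; apply: sqnB_eq0; [exact: L2_rot|exact: L2_rot|].
by rewrite -rotB sqn_rot ?sqnB_ae0//; exact: L2B.
Qed.

Lemma rot_inner h k : L2 h -> L2 k -> L2_inner (rot h) (rot k) = L2_inner h k.
Proof.
move=> Lh Lk; have := sqn_rot (L2B Lh Lk); rewrite rotB.
have Lrh := L2_rot Lh; have Lrk := L2_rot Lk.
rewrite (sqnB Lrh Lrk) (sqnB Lh Lk) !sqn_rot//; lra.
Qed.

End Rotation.

Lemma rotK (R : realType) (th h : R -> R) : (forall w, th (- w) = - th w) ->
  rot th (rot (\- th) h) = h.
Proof.
move=> thN; apply/funext => w; rewrite /rot /= thN opprK !cosN sinN !opprK.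
have := cos2Dsin2 (th w); move: (cos _) (sin _) => c s E.
rewrite -[RHS]mul1r -E; ring.
Qed.

Section TemperedDerivative.
Local Open Scope complex_scope.
Context {R : realType}.
Local Notation mu := (@lebesgue_measure R).
Variables (kappa lam : R).
Implicit Types (f h k phi psi : R -> R) (w x : R).

(** [weight] and [phase] are the modulus and the argument of (lam - i w)^kappa. *)
Definition weight w : R := Num.sqrt (lam ^+ 2 + w ^+ 2) `^ kappa.

Definition phase w : R := kappa * atan (- w / lam).

Lemma phaseN w : phase (- w) = - phase w.
Proof. by rewrite /phase mulNr atanN mulrN. Qed.

Lemma weightN w : weight (- w) = weight w.
Proof. by rewrite /weight sqrrN. Qed.

Lemma measurable_phase : measurable_fun setT phase.
Proof.
apply: measurable_funM => //.
have catan : continuous (@atan R) by move=> x; exact: continuous_atan.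
apply: (measurableT_comp (continuous_measurable_fun catan)).
by apply: measurable_funM.
Qed.

Lemma measurable_weight : measurable_fun setT weight.
Proof.
apply: (measurableT_comp (measurable_powR _)).
apply: (measurableT_comp (continuous_measurable_fun (@sqrt_continuous R))).
by apply: measurable_funD => //; exact: measurable_funX.
Qed.

Lemma weight_sqr w : weight w ^+ 2 = (lam ^+ 2 + w ^+ 2) `^ kappa.
Proof. by rewrite /weight expr2 -powRM ?sqrtr_ge0// -expr2 sqr_sqrtr// addr_ge0 ?sqr_ge0. Qed.

Definition hmul h := rot phase (fun w => weight w * h w).

Lemma cpow_of_hartley h w :
  cpow (lam -i* w) kappa * of_hartley h w = of_hartley (hmul h) w.
Proof.
rewrite /cpow /of_hartley /hmul /rot phaseN weightN opprK cosN sinN /sqnormc /= sqrrN.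
rewrite -/(weight w) -/(phase w).
by congr (_ +i* _) => /=; field.
Qed.

Lemma L2_weight_of_hmul h : measurable_fun setT h -> L2 (hmul h) ->
  L2 (fun w => weight w * h w).
Proof.
move=> mh Lh; have mth : measurable_fun setT (\- phase).
  by apply: measurableT_comp => //; exact: measurable_phase.
have := L2_rot mth Lh; rewrite /hmul.
have {2}-> : phase = \- (\- phase) by apply/funext => w /=; rewrite opprK.
by rewrite rotK// => w /=; rewrite phaseN.
Qed.

(** Forward, g may be replaced by [of_hartley h] almost everywhere, and the multiplier then acts as
    [hmul]. Backward, the Sobolev integral is the squared norm of [hmul h]. *)
Lemma tempered_derivP f phi : is_tempered_deriv kappa lam f phi <->
  exists2 h, is_hartley f h & is_hartley phi (hmul h).
Proof.
split=> [[_ Lphi [g fg phig]]|[h fh phih]].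
  pose h w := complex.Re (g w) - complex.Im (g w).
  have fh : is_hartley f h := is_fourier_hartley fg.
  exists h => //; have := is_fourier_hartley phig => Hphi.
  have [_ Lh _] := fh; have [_ LH _] := Hphi.
  set H := (fun w => _ - _) in Hphi LH.
  have mH : measurable_fun setT (hmul h).
    apply: (measurable_rot measurable_phase).
    by apply: measurable_funM; [exact: measurable_weight|exact: L2_measurable].
  have HE : H = hmul h %[ae mu].
    apply: filterS (is_fourier_hermitian fg) => w gE Dw.
    rewrite /H gE// cpow_of_hartley /of_hartley  /=.
    by rewrite -/h; field.
  exact: (is_hartley_aer Hphi (L2_ae LH mH HE) HE).
have [Lf Lh _] := fh; have [Lphi LH _] := phih.
have ff := is_fourier_of_hartley fh.
have fphi : is_fourier phi (fun w => cpow (lam -i* w) kappa * of_hartley h w).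
  under eq_fun do rewrite cpow_of_hartley; exact: is_fourier_of_hartley.
split=> //; last by exists (of_hartley h).
split=> //; exists (of_hartley h) => //.
rewrite (_ : (\int[mu]_w _)%E = (sqn (hmul h))%:E) ?ltry//.
rewrite -integral_sqnormc_of_hartley//; apply: eq_integral => w _; congr EFin.
rewrite -cpow_of_hartley /sqnormc -weight_sqr /cpow /= /sqnormc/= sqrrN -/(weight w).
have := cos2Dsin2 (kappa * atan (- w / lam)).
move: (cos _) (sin _) (weight w) => c s r E.
(* Inserting c^2 + s^2 = 1 leaves an identity of polynomials. *)
set L := LHS; have -> : L = (c ^+ 2 + s ^+ 2) * L by rewrite E mul1r.
by rewrite /L; field.
Qed.

End TemperedDerivative.

(** * Elementary functions *)

Section Elementary.
Context {R : realType}.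
Local Notation mu := (@lebesgue_measure R).
Implicit Types (f h : R -> R) (a b w x : R) (s : seq (R * (R * R))).

(** The factor (k < j) pads the telescoping sum to a range independent of j, so that sums for
    different endpoints can be combined. *)
Lemma sitv_telescope (t : nat -> R) (j m : nat) x : (j <= m)%N ->
  sitv (t 0%N) (t j) x = \sum_(k < m) (k < j)%N%:R * sitv (t k) (t k.+1) x.
Proof.
elim: m j => [|m IH] j; first by rewrite leqn0 => /eqP->; rewrite big_ord0 /sitv subrr.
rewrite leq_eqVlt ltnS => /predU1P[->|jm].
  rewrite big_ord_recr/= ltnSn mul1r -(sitvD _ (t m)) (IH m)//; congr (_ + _).
  by apply: eq_bigr => k _; rewrite ltnS ltn_ord ltnW.
by rewrite big_ord_recr/= ltnNge jm mul0r addr0 -IH.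
Qed.

(** The sorted distinct endpoints cut the line into gaps; the coefficient on a gap adds up the terms
    whose interval contains it, with a minus sign for reversed intervals. *)
Lemma stepf_elementary s : elementary (stepf s).
Proof.
pose e := sort <=%R (undup (flatten [seq [:: p.2.1; p.2.2] | p <- s])).
pose t i := nth 0 e i.
have mem_e p : p \in s -> p.2.1 \in e /\ p.2.2 \in e.
  move=> ps; split; rewrite mem_sort mem_undup; apply/flattenP;
    exists [:: p.2.1; p.2.2]; rewrite ?inE ?eqxx ?orbT//;
    by apply/mapP; exists p.
have te a : a \in e -> a = t (index a e) by move=> ae; rewrite /t nth_index.
have ie a : a \in e -> (index a e <= (size e).-1)%N.
  by rewrite -index_mem; case: (size e).
pose c (k : nat) : R :=
  \sum_(p <- s) p.1 * ((k < index p.2.2 e)%N%:R - (k < index p.2.1 e)%N%:R).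
(* One gap fewer than endpoints; the empty list gives no gap at all. *)
exists (size e).-1, (fun i => c i), t; split.
- move=> i; have ilt : (i.+1 < size e)%N by rewrite -ltn_predRL.
  have : sorted <%R e by rewrite sort_lt_sorted undup_uniq.
  by move=> /(sortedP 0) /(_ i ilt).
- apply/funext => x.
  under eq_bigr => i _.
    rewrite -sitv_indic; last first.
      have : sorted <=%R e by apply: sort_sorted; exact: le_total.
      move=> /(sortedP 0); apply.
      by rewrite -ltn_predRL.
    rewrite mulr_suml; over.
  rewrite exchange_big /stepf /=; apply: eq_big_seq => p /mem_e[p1 p2].
  rewrite (te _ p1) (te _ p2) -(sitvD _ (t 0%N)) sitv_opp addrC.
  rewrite (sitv_telescope t x (ie _ p1)) (sitv_telescope t x (ie _ p2)) -!te//.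
  rewrite -sumrB mulr_sumr; apply: eq_bigr => k _; ring.
Qed.

Lemma elementary_stepf f : elementary f -> exists s, f = stepf s.
Proof.
move=> [n [a [t [tlt ->]]]].
exists [seq (a i, (t i, t i.+1)) | i <- index_enum 'I_n].
apply/funext => x; rewrite /stepf big_map; apply: eq_bigr => i _ /=.
by rewrite sitv_indic// ltW.
Qed.

Local Notation c0 := (@hartley_norm R).

(** For each w other than 0 the truncated transforms are constant once the window contains both
    endpoints. *)
Lemma is_hartley_sitv a b : is_hartley (sitv a b) (fun w => c0 * hitv a b w).
Proof.
have Ls := L2_sitv a b; have [h sh] := is_hartley_exists Ls.
have [_ Lh hcvg] := sh.
have [|LH hE] := L2cvg_pointwise_neq0 (fun n => L2_hart n Ls) Lh hcvg
  (g := fun w => c0 * hitv a b w); last exact: (is_hartley_aer sh).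
move=> w w0; apply: cvg_cstM; apply: cvg_near_cst.
have [N1 _ H1] := nbhs_infty_gtr `|a|; have [N2 _ H2] := nbhs_infty_gtr `|b|.
exists (maxn N1 N2) => // n /=; rewrite geq_max => /andP[/H1 an /H2 bn].
apply: hart0_sitv => //.
- by rewrite -ler_norml ltW.
- by rewrite -ler_norml ltW.
Qed.

End Elementary.

(** * The space of tempered derivatives *)

Section TemperedSpace.
Context {R : realType}.
Local Notation mu := (@lebesgue_measure R).
Variables (kappa lam : R).
Hypotheses (kappa_gt0 : 0 < kappa) (kappa_lt : kappa < 2^-1) (lam_gt0 : 0 < lam).
Implicit Types (f g h k phi psi q : R -> R) (a b w x : R).
Local Notation td := (is_tempered_deriv kappa lam).
Local Notation weight := (weight kappa lam).
Local Notation phase := (phase kappa lam).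
Local Notation hmul := (hmul kappa lam).
Local Notation c0 := (@hartley_norm R).

Let mphase : measurable_fun setT phase := measurable_phase kappa lam.
Let phaseN' w : phase (- w) = - phase w := phaseN kappa lam w.

Lemma weight_ge w : lam `^ kappa <= weight w.
Proof.
apply: ge0_ler_powR; rewrite ?nnegrE ?sqrtr_ge0// ?(ltW kappa_gt0) ?(ltW lam_gt0)//.
rewrite -[leLHS](gtr0_norm lam_gt0) -sqrtr_sqr ler_sqrt ?addr_ge0 ?sqr_ge0//.
by rewrite lerDl sqr_ge0.
Qed.

Lemma weight_gt0 w : 0 < weight w.
Proof. exact: lt_le_trans (powR_gt0 _ lam_gt0) (weight_ge w). Qed.

Lemma hmul_lin a b h k :
  hmul (fun w => a * h w + b * k w) = (fun w => a * hmul h w + b * hmul k w).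
Proof. by apply/funext => w; rewrite /hmul /rot; ring. Qed.

Lemma td_L2 f phi : td f phi -> L2 f /\ L2 phi.
Proof. by move=> /tempered_derivP[h [] Lf _ _ [Lphi _ _]]. Qed.

Lemma td_lin a b f g phi psi : td f phi -> td g psi ->
  td (fun x => a * f x + b * g x) (fun x => a * phi x + b * psi x).
Proof.
move=> /tempered_derivP[h fh phih] /tempered_derivP[k gk psik].
apply/tempered_derivP; exists (fun w => a * h w + b * k w).
  exact: is_hartley_lin.
by rewrite hmul_lin; exact: is_hartley_lin.
Qed.

Lemma tdB f g phi psi : td f phi -> td g psi -> td (f \- g) (phi \- psi).
Proof.
have E u v : (fun x => 1 * u x + (-1) * v x) = u \- v :> (R -> R).
  by apply/funext => x; rewrite mul1r mulN1r.
by move=> Hf Hg; have := td_lin 1 (-1) Hf Hg; rewrite !E.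
Qed.

Lemma td0 : td (cst 0) (cst 0).
Proof.
apply/tempered_derivP; exists (cst 0); first exact: is_hartley0.
have -> : hmul (cst 0) = cst 0; last exact: is_hartley0.
by apply/funext => w; rewrite /hmul /rot !mulr0 subrr.
Qed.

Lemma td_ae f g phi : td f phi -> measurable_fun setT g -> f = g %[ae mu] -> td g phi.
Proof.
move=> /tempered_derivP[h fh phih] mg fg; apply/tempered_derivP; exists h; last exact: phih.
exact: is_hartley_ael fh mg fg.
Qed.

Lemma td_unique f phi psi : td f phi -> td f psi -> phi = psi %[ae mu].
Proof.
move=> /tempered_derivP[h fh phih] /tempered_derivP[k fk psik].
have [_ Lh _] := fh; have [_ Lk _] := fk; have [_ LH _] := phih; have [_ LK _] := psik.
apply: (is_hartley_inj phih psik).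
apply: (rot_ae mphase phaseN').
- exact: L2_weight_of_hmul (L2_measurable Lh) LH.
- exact: L2_weight_of_hmul (L2_measurable Lk) LK.
- by apply: filterS (is_hartley_unique fh fk) => w H Dw; rewrite H.
Qed.

(** The weight never vanishes; this gives definiteness of the inner product. *)
Lemma td_inj f phi : td f phi -> phi = cst 0 %[ae mu] -> f = cst 0 %[ae mu].
Proof.
move=> H phi0; have [Lf Lphi] := td_L2 H; move/tempered_derivP: H => [h fh phih].
have [_ Lh _] := fh; have [_ LH _] := phih.
have Lwh := L2_weight_of_hmul (L2_measurable Lh) LH.
have wh0 : sqn (fun w => weight w * h w) = 0.
  rewrite -(sqn_rot mphase phaseN' Lwh) (is_hartley_sqn phih).
  by rewrite (sqn_ae Lphi L2_0 phi0) sqn_cst0 mulr0.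
apply: (is_hartley_inj fh is_hartley0).
apply: filterS (sqn_eq0 Lwh wh0) => w /(_ I) /eqP.
by rewrite mulf_eq0 gt_eqF ?weight_gt0//= => /eqP ->.
Qed.

(** Undo the rotation, then divide by the weight: its inverse is at most lam^-kappa, so the quotient
    is in L^2 and is the transform of some f. *)
Lemma td_surj phi : L2 phi -> exists f, td f phi.
Proof.
move=> Lphi; have [K phiK] := is_hartley_exists Lphi; have [_ LK _] := phiK.
have mN : measurable_fun setT (\- phase) by exact: measurableT_comp.
have LrK := L2_rot mN LK.
pose h w := (weight w)^-1 * rot (\- phase) K w.
have mh : measurable_fun setT h.
  apply: measurable_funM; last exact: L2_measurable.
  by apply: (measurableT_comp (@measurable_inv R)); exact: measurable_weight.
have l0 : 0 < lam `^ kappa by exact: powR_gt0.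
have Lh : L2 h.
  apply: (L2_le mh (L2Z (lam `^ kappa)^-1 LrK)) => w.
  rewrite !normrM ler_wpM2r// !gtr0_norm ?invr_gt0 ?weight_gt0//.
  by rewrite lef_pV2 ?posrE ?weight_gt0// weight_ge.
have [f fh] := is_hartley_surj Lh.
exists f; apply/tempered_derivP; exists h; first exact: fh.
have -> : hmul h = K; last by [].
rewrite /hmul (_ : (fun w => weight w * h w) = rot (\- phase) K) ?rotK//.
by apply/funext => w; rewrite /h mulrA divff ?mul1r// gt_eqF// weight_gt0.
Qed.

Lemma L2_weight_hitv a b : L2 (fun w => weight w * hitv a b w).
Proof.
apply/L2P; split.
  by apply: measurable_funM; [exact: measurable_weight|exact: measurable_hitv].
under eq_integral do rewrite exprMn weight_sqr.
by apply: integral_weight_hitv; rewrite (ltW kappa_gt0).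
Qed.

Lemma td_sitv a b : exists phi, is_hartley phi (hmul (fun w => c0 * hitv a b w)).
Proof.
apply: is_hartley_surj; apply: (L2_rot mphase).
have := L2Z c0 (L2_weight_hitv a b); congr L2; apply/funext => w; ring.
Qed.

Lemma td_stepf s : exists phi, td (stepf s) phi.
Proof.
elim: s => [|p s [phi IH]].
  have E : stepf [::] = cst 0 :> (R -> R) by apply/funext => x; rewrite /stepf big_nil.
  by exists (cst 0); rewrite E; exact: td0.
have [psi psiE] := td_sitv p.2.1 p.2.2.
have H : td (sitv p.2.1 p.2.2) psi.
  by apply/tempered_derivP; eexists; [exact: is_hartley_sitv|exact: psiE].
exists (fun x => p.1 * psi x + 1 * phi x).
have -> : stepf (p :: s) = (fun x => p.1 * sitv p.2.1 p.2.2 x + 1 * stepf s x).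
  by apply/funext => x; rewrite /stepf big_cons mul1r.
exact: td_lin.
Qed.

Lemma hart0_cvg (u : R -> R) w : L2 u -> mu.-integrable setT (EFin \o u) ->
  hart0 u n w @[n --> \oo] --> \int[mu]_x (u x * cas (w * x)).
Proof.
move=> Lu iu.
have mcw : measurable_fun setT (fun x => cas (w * x)).
  by apply: (measurableT_comp (@measurable_cas R)); exact: measurable_funM.
have mE n : measurable_fun setT (fun x => (u x * cas_trunc n w x)%:E).
  apply/measurable_EFinP; apply: measurable_funM; first exact: L2_measurable.
  by apply: L2_measurable; exact: L2_cas_trunc.
have [|||| i _ H] := @dominated_convergence _ _ _ mu setT measurableT
  (fun n x => (u x * cas_trunc n w x)%:E) (fun x => (u x * cas (w * x))%:E)
  (fun x => 2%:E * `|(u x)%:E|)%E mE.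
- by apply/measurable_EFinP; apply: measurable_funM => //; exact: L2_measurable.
- apply: aeW => x _; apply: cvg_near_cst.
  have [N _ HN] := nbhs_infty_gtr `|x|.
  exists N => // n /= Nn; congr EFin; congr (_ * _); rewrite /cas_trunc indicE mem_set ?mulr1//.
  have := HN n Nn; rewrite ltr_norml => /andP[xl xr].
  by rewrite /window/= in_itv/= xr ltW.
- by apply: integrableZl => //; exact: integrable_abse.
- apply: aeW => x n _; rewrite /= lee_fin normrM mulrC ler_wpM2r//.
  rewrite /cas_trunc indicE; case: (_ \in _); first by rewrite mulr1 norm_cas_le2.
  by rewrite mulr0 normr0.
have iw : mu.-integrable setT (EFin \o (fun x => u x * cas (w * x))) by exact: i.
suff : (hart0 u n w)%:E @[n --> \oo] --> (\int[mu]_x (u x * cas (w * x)))%:E.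
  by move=> /fine_cvgP[].
rewrite /Rintegral fineK; last exact: integrable_fin_num.
have -> : (fun n => (hart0 u n w)%:E) = (fun n => \int[mu]_x (u x * cas_trunc n w x)%:E)%E.
  by apply/funext => n; rewrite L2_inner_EFin//; exact: L2_cas_trunc.
exact: H.
Qed.

(** For u in both L^1 and L^2 the truncated transforms tend pointwise to the integral, here 0, so
    the L^2 transform is null and the isometry concludes. *)
Lemma eq0_of_cas_integral (u : R -> R) : L2 u -> mu.-integrable setT (EFin \o u) ->
  (forall w, \int[mu]_x (u x * cas (w * x)) = 0) -> u = cst 0 %[ae mu].
Proof.
move=> Lu iu u0; have [h uh] := is_hartley_exists Lu; have [_ Lh hcvg] := uh.
have [|_ h0] := L2cvg_pointwise (fun n => L2_hart n Lu) Lh hcvg (g := cst 0).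
  move=> w; rewrite /= -[X in _ --> X](mulr0 c0) -(u0 w).
  by apply: cvg_cstM; exact: hart0_cvg.
apply: sqn_eq0 => //; have := is_hartley_sqn uh.
rewrite (sqn_ae Lh L2_0 h0) sqn_cst0 => /esym/eqP.
by rewrite mulf_eq0 gt_eqF ?hartley_const_gt0//= => /eqP.
Qed.

(** As kappa <= 1, the squared weight is at most 1 + lam^2 + w^2; the first two terms use |sinc| <=
    |a|, the last uses |w sinc| <= 1. The final 1 replaces a square root. *)
Lemma norm_weight_sinc_le a w :
  `|weight w * sinc a w| <= (1 + lam ^+ 2) * a ^+ 2 + 1 + 1.
Proof.
set B := (1 + lam ^+ 2) * a ^+ 2 + 1.
have B0 : 0 <= B by rewrite addr_ge0// mulr_ge0 ?sqr_ge0// addr_ge0 ?sqr_ge0.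
suff : `|weight w * sinc a w| ^+ 2 <= B.
  move: (`|_|) => z zB; rewrite leNgt; apply/negP => Bz.
  have B1 : 0 <= B + 1 by rewrite addr_ge0.
  have := ltr_pM B1 B1 Bz Bz; move: (B) B0 zB => b b0 zb; nra.
rewrite real_normK ?num_real// exprMn weight_sqr.
have kle : (lam ^+ 2 + w ^+ 2) `^ kappa <= 1 + lam ^+ 2 + w ^+ 2.
  have s0 : 0 <= lam ^+ 2 + w ^+ 2 by rewrite addr_ge0 ?sqr_ge0.
  apply: (@le_trans _ _ ((1 + lam ^+ 2 + w ^+ 2) `^ kappa)).
    by apply: ge0_ler_powR; rewrite ?nnegrE ?(ltW kappa_gt0)//; lra.
  apply: ler1_powR; first by rewrite -addrA lerDl.
  by have := kappa_lt; lra.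
apply: (@le_trans _ _ ((1 + lam ^+ 2 + w ^+ 2) * sinc a w ^+ 2)).
  by rewrite ler_wpM2r ?sqr_ge0.
rewrite mulrDl; apply: lerD.
  rewrite ler_wpM2l ?addr_ge0 ?sqr_ge0//.
  rewrite -(real_normK (num_real (sinc a w))) -(real_normK (num_real a)).
  by rewrite lerXn2r ?nnegrE// norm_sinc_le.
rewrite -exprMn -(real_normK (num_real (w * _))) expr_le1// normrM.
have [->|w0] := eqVneq w 0; first by rewrite normr0 mul0r.
by rewrite mulrC -ler_pdivlMr ?normr_gt0// mul1r norm_sinc_le_inv.
Qed.

(** Taking m + 1 > |w| keeps the argument of the sine within ]-pi, pi[ and away from 0. *)
Lemma sinc_neq0 w : w != 0 -> exists m : nat, sinc m.+1%:R^-1 w != 0.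
Proof.
move=> w0; have [N _ HN] := nbhs_infty_gtr `|w|.
exists N; rewrite mulf_neq0 ?invr_neq0//.
have wN : `|w| < N.+1%:R by apply: HN => /=.
set x := _ * w; have x0 : x != 0 by rewrite mulf_neq0 ?invr_neq0 ?pnatr_eq0.
have x1 : `|x| < pi.
  apply: (@lt_le_trans _ _ 2); last exact: pi_ge2.
  rewrite normrM ger0_norm ?invr_ge0// mulrC ltr_pdivrMr ?ltr0n//.
  by apply: (lt_trans wN); rewrite ltr_pMl ?ltr0n// ltr1n.
have [xp|xn|xe] := ltrgt0P x; last by rewrite xe eqxx in x0.
- by rewrite gt_eqF// sin_gt0_pi// xp; rewrite gtr0_norm in x1.
- rewrite -oppr_eq0 -sinN gt_eqF// sin_gt0_pi// oppr_gt0 xn.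
  by rewrite ltr0_norm in x1.
Qed.

(* The transform of a centred window factors as [2 * cas (a * w) * sinc delta w],
   so orthogonality to all windows says that a function of [L^1] and [L^2] has
   vanishing transform. *)
Lemma td_orthogonal q : L2 q ->
  (forall s phi, td (stepf s) phi -> L2_inner q phi = 0) -> q = cst 0 %[ae mu].
Proof.
move=> Lq qorth; have [k qk] := is_hartley_exists Lq; have [_ Lk _] := qk.
have mN : measurable_fun setT (\- phase) by exact: measurableT_comp.
(* Writing k as [rot phase p] lets the isometry cancel the rotation in [hmul], leaving the integrand
   p * weight * hitv with no reflected values. *)
pose p := rot (\- phase) k; have Lp : L2 p := L2_rot mN Lk.
have kE : k = rot phase p by rewrite /p rotK.
have mws delta : measurable_fun setT (fun w => weight w * sinc delta w).
  by apply: measurable_funM; [exact: measurable_weight|exact: measurable_sinc].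
have Lws delta : L2 (fun w => weight w * sinc delta w).
  apply/L2P; split; first exact: mws.
  under eq_integral do rewrite exprMn weight_sqr.
  by apply: integral_weight_sinc; rewrite (ltW kappa_gt0).
pose u delta w := p w * (weight w * sinc delta w).
have u0 delta : u delta = cst 0 %[ae mu].
  have iu := L2_mulr_integrable Lp (Lws delta).
  have Lu : L2 (u delta).
    pose B := (1 + lam ^+ 2) * delta ^+ 2 + 1 + 1.
    apply: (L2_le _ (L2Z B Lp)) => [|w].
      by apply: measurable_funM => //; exact: L2_measurable.
    rewrite (normrM (p w)) (normrM B) mulrC ler_wpM2r//.
    apply: (le_trans (norm_weight_sinc_le delta w)); exact: ler_norm.
  apply: eq0_of_cas_integral => // a.
  have [psi psiE] := td_sitv (a - delta) (a + delta).
  have tpsi : td (stepf [:: (1, (a - delta, a + delta))]) psi.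
    apply/tempered_derivP; eexists; last exact: psiE.
    by rewrite -sitv_stepf; exact: is_hartley_sitv.
  have := is_hartley_inner qk psiE; rewrite (qorth _ _ tpsi) mulr0 kE /hmul.
  have Lwh : L2 (fun w => weight w * (c0 * hitv (a - delta) (a + delta) w)).
    have := L2Z c0 (L2_weight_hitv (a - delta) (a + delta)).
    by congr L2; apply/funext => w; ring.
  rewrite (rot_inner mphase phaseN' Lp Lwh).
  have c0n : c0 != 0 by rewrite gt_eqF// hartley_norm_gt0.
  have := L2_inner_linr (2 * c0)^-1 0 Lwh L2_0 Lp => + E0.
  rewrite E0 !mulr0 mul0r addr0 => <-; apply: eq_Rintegral => w _.
  rewrite mulr0 addr0 /u /hitv.
  have -> : (a - delta + (a + delta)) / 2 = a by field.
  have -> : (a + delta - (a - delta)) / 2 = delta by field.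
  by field.
have p0 : p = cst 0 %[ae mu].
  have ae_u : {ae mu, forall w, forall m : nat, u m.+1%:R^-1 w = 0}.
    by apply: ae_foralln => m; apply: filterS (u0 m.+1%:R^-1) => w; apply.
  apply: filterS2 ae_u ae_neq0 => w uw w0 _; have [m sm] := sinc_neq0 w0.
  have /eqP := uw m.
  rewrite mulf_eq0 (mulf_eq0 (weight w)) (negPf sm) (gt_eqF (weight_gt0 w)) !orbF.
  by move/eqP.
apply: sqn_eq0 => //; have := is_hartley_sqn qk; rewrite kE (sqn_rot mphase phaseN' Lp).
rewrite (sqn_ae Lp L2_0 p0) sqn_cst0 => /esym/eqP.
by rewrite mulf_eq0 gt_eqF ?hartley_const_gt0//= => /eqP.
Qed.

Lemma td_dense f phi (eps : R) : td f phi -> 0 < eps ->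
  exists s psi, td (stepf s) psi /\ sqn (phi \- psi) < eps.
Proof.
move=> fphi eps0; have [Lf Lphi] := td_L2 fphi.
pose M := [set psi | exists s, td (stepf s) psi].
have [||||psi [s spsi] H] := @L2_dense_of_orthogonal R M _ _ _ _ phi Lphi eps eps0.
- exists [::]; have -> : stepf [::] = cst 0 :> (R -> R).
    by apply/funext => x; rewrite /stepf big_nil.
  exact: td0.
- by move=> psi [s /td_L2[]].
- move=> a psi psi' [s sE] [t tE]; have [v vE] := stepf_lin a s t; exists v.
  rewrite vE; have := td_lin a 1 sE tE.
  have E (g g' : R -> R) : (fun x => a * g x + 1 * g' x) = (fun x => a * g x + g' x).
    by apply/funext => x; rewrite mul1r.
  by rewrite !E.
- move=> q Lq qM; apply: td_orthogonal => // s psi spsi.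
  by apply: qM; exists s.
- by exists s, psi.
Qed.

End TemperedSpace.

(** * The space [A2], its inner product, density and completeness *)

Section A2Space.
Context {R : realType}.
Local Notation mu := (@lebesgue_measure R).
Variables (d lam : R).
Hypotheses (d_gt : - 2^-1 < d) (d_lt0 : d < 0) (lam_gt0 : 0 < lam).
Implicit Types (f g phi psi : R -> R).
Local Notation td := (is_tempered_deriv (- d) lam).

Let kappa_gt0 : 0 < - d. Proof. by rewrite oppr_gt0. Qed.
Let kappa_lt : - d < 2^-1. Proof. by rewrite ltrNl. Qed.

Lemma A2P f : A2 d lam f <-> exists phi, td f phi.
Proof.
split=> [[_ [phi _ fphi]]|[phi fphi]]; first by exists phi.
by have [sf Lphi _] := fphi; split=> //; exists phi.
Qed.

Lemma A2_phiP f : A2 d lam f -> td f (A2_phi d lam f).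
Proof. by move=> /A2P fphi; have := xgetPex (cst 0) fphi. Qed.

(** [A2_phi] picks some representative; uniqueness of the derivative almost everywhere makes the
    choice immaterial. *)
Lemma A2_innerE f g phi psi : td f phi -> td g psi ->
  A2_inner d lam f g = L2_inner phi psi.
Proof.
move=> fphi gpsi.
have Af : A2 d lam f by apply/A2P; exists phi.
have Ag : A2 d lam g by apply/A2P; exists psi.
apply: L2_inner_ae.
- exact: (td_L2 (A2_phiP Af)).2.
- exact: (td_L2 (A2_phiP Ag)).2.
- exact: (td_L2 fphi).2.
- exact: (td_L2 gpsi).2.
- exact: td_unique (A2_phiP Af) fphi.
- exact: td_unique (A2_phiP Ag) gpsi.
Qed.

Lemma A2_normE f phi : td f phi -> ip_norm (A2_inner d lam) f = Num.sqrt (sqn phi).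
Proof. by move=> fphi; rewrite /ip_norm (A2_innerE fphi fphi). Qed.

Lemma lin1E (a : R) (u v : R -> R) :
  (fun x => a * u x + 1 * v x) = (fun x => a * u x + v x).
Proof. by apply/funext => x; rewrite mul1r. Qed.

Lemma td_add a f g phi psi : td f phi -> td g psi ->
  td (fun x => a * f x + g x) (fun x => a * phi x + psi x).
Proof. by move=> fphi gpsi; have := td_lin a 1 fphi gpsi; rewrite !lin1E. Qed.

Lemma A2_linear_space : ae_linear_space (A2 d lam).
Proof.
split.
- by apply/A2P; exists (cst 0); exact: td0.
- move=> a f g /A2P[phi fphi] /A2P[psi gpsi]; apply/A2P.
  by eexists; exact: (td_add a fphi gpsi).
- move=> f g /A2P[phi fphi] mg fg; apply/A2P; exists phi.
  exact: td_ae fphi mg fg.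
Qed.

Lemma A2_inner_product : ae_inner_product (A2 d lam) (A2_inner d lam).
Proof.
split.
- by move=> f g _ _; exact: L2_innerC.
- move=> a f g h /A2P[phi fphi] /A2P[psi gpsi] /A2P[chi hchi].
  rewrite (A2_innerE (td_add a fphi gpsi) hchi) (A2_innerE fphi hchi) (A2_innerE gpsi hchi).
  have := L2_inner_linl a 1 (td_L2 fphi).2 (td_L2 gpsi).2 (td_L2 hchi).2.
  by rewrite lin1E mul1r.
- by move=> f _; exact: sqn_ge0.
- move=> f /A2P[phi fphi]; rewrite (A2_innerE fphi fphi).
  have [Lf Lphi] := td_L2 fphi.
  split=> [/(sqn_eq0 Lphi)|f0]; first exact: td_inj lam_gt0 _ _ fphi.
  (* A null f also has derivative 0, with which its norm may be computed. *)
  have t0 : td f (cst 0).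
    apply: (td_ae (td0 (- d) lam) (L2_measurable Lf)).
    by apply: filterS f0 => x H Dx; rewrite H.
  by rewrite -(A2_innerE fphi fphi) (A2_innerE t0 t0); exact: sqn_cst0.
Qed.

Lemma A2_elementary_dense : ip_dense (A2 d lam) (A2_inner d lam) (@elementary R).
Proof.
split=> [f /elementary_stepf[s ->]|f eps /A2P[phi fphi] eps0].
  by apply/A2P; exact: td_stepf.
have e2 : 0 < eps ^+ 2 by rewrite exprn_gt0.
have [s [psi [spsi H]]] := td_dense kappa_gt0 kappa_lt lam_gt0 fphi e2.
exists (stepf s); first exact: stepf_elementary.
rewrite (A2_normE (tdB fphi spsi)) -(gtr0_norm eps0) -sqrtr_sqr.
by rewrite ltr_sqrt.
Qed.

Lemma A2_complete : ip_complete (A2 d lam) (A2_inner d lam).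
Proof.
move=> u Au Cu; pose phi n := A2_phi d lam (u n).
have uphi n : td (u n) (phi n) by exact: A2_phiP.
have Lphi n : L2 (phi n) := (td_L2 (uphi n)).2.
have Cphi : sqn_cauchy phi.
  move=> eps eps0; have e0 : 0 < Num.sqrt eps by rewrite sqrtr_gt0.
  have [N HN] := Cu _ e0; exists N => m n Nm Nn.
  have := HN m n Nm Nn; rewrite (A2_normE (tdB (uphi m) (uphi n))) ltr_sqrt//.
  exact: ltW.
have [psi Lpsi phipsi] := L2_complete Lphi Cphi.
have [f fpsi] := td_surj kappa_gt0 lam_gt0 Lpsi.
exists f; first by apply/A2P; exists psi.
apply: (sqr_cvg0 _ phipsi) => n.
by rewrite (A2_normE (tdB (uphi n) fpsi)) sqr_sqrtr ?sqn_ge0.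
Qed.

End A2Space.

Theorem theorem3p9 (R : realType) (d lam : R)
    (hd1 : - 2^-1 < d) (hd0 : d < 0) (hlam : 0 < lam) :
  [/\ ae_linear_space (A2 d lam),
      (forall f g phi psi : R -> R,
         is_tempered_deriv (- d) lam f phi ->
         is_tempered_deriv (- d) lam g psi ->
         A2_inner d lam f g = L2_inner phi psi) /\
      ae_inner_product (A2 d lam) (A2_inner d lam),
      ip_dense (A2 d lam) (A2_inner d lam) (@elementary R) &
      ip_complete (A2 d lam) (A2_inner d lam)].
Proof.
split.
- exact: A2_linear_space.
- split; [exact: A2_innerE|exact: A2_inner_product].
- exact: A2_elementary_dense.
- exact: A2_complete.
Qed.
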